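(* Let $d\ge 3$, let $\beta>0$ be so small that $\alpha_d\lambda<1$, and let $(x,s)\in\mathbb{Z}^d\times\mathbb{R}$. As $t\to\infty$, the normalized point-to-line partition function $Z_{x,s}^t$ converges in $L^2(Q)$ to a limiting partition function $Z_{x,s}^\infty$.
   Context: Let $d\ge 3$. Let $\eta$ be the continuous-time simple symmetric random walk on $\mathbb{Z}^d$: its jump times form a rate-1 Poisson point process and at each jump it moves to one of the $2d$ nearest neighbours with equal probability. $\mathbf{P}_{x,s}$, $\mathbf{E}_{x,s}$ denote law and expectation when $\eta_s=x$; for $t>s$, $\mathbf{E}_{x,s}^{y,t}$ is expectation under $\mathbf{P}_{x,s}$ conditioned on $\{\eta_t=y\}$. Put $p_t^z=\mathbf{P}_{0,0}(\eta_t=z)$, and let $q_n^z$ be the $n$-step transition probability from $0$ to $z$ of the discrete-time simple symmetric random walk on $\mathbb{Z}^d$. Environment: $\Omega$ is the set of functions $\omega:\mathbb{Z}^d\times\mathbb{R}\to\mathbb{R}$ such that for each $x$, $t\mapsto\omega(x,t)$ is continuous with $\omega(x,0)=0$; $(\Omega,\mathcal{F},Q)$ is the completed canonical probability space under which $W^x_t(\omega)=\omega(x,t)$, $x\in\mathbb{Z}^d$, are independent two-sided standard Wiener processes. $\langle\cdot\rangle$ is expectation under $Q$. For a walk path on $[s,t)$ with $n$ jumps at times $s<s_1<\dots<s_n<t$ and successive sites $\gamma_0,\dots,\gamma_n$, put $s_0=s$, $s_{n+1}=t$, and define the action $\mathcal{A}_s^t(\eta,\omega)=\sum_{j=0}^{n}(\omega(\gamma_j,s_{j+1})-\omega(\gamma_j,s_j))$.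 For $\beta>0$ and $s<t$ define $$Z_{x,s}^{y,t}(\omega)=e^{-\frac{\beta^2}{2}(t-s)}\,p_{t-s}^{y-x}\,\mathbf{E}_{x,s}^{y,t}e^{\beta\mathcal{A}_s^t(\cdot,\omega)},\qquad Z_{x,s}^t=\sum_{y\in\mathbb{Z}^d}Z_{x,s}^{y,t}.$$ Finally $\alpha_d=\sum_{n=1}^\infty\sum_{z\in\mathbb{Z}^d}(q_n^z)^2$ (finite as $d\ge3$) and $\lambda=\mathbf{E}[e^{\beta^2\tau}-1]$ for $\tau$ exponential with rate $1$, i.e. $\lambda=\beta^2/(1-\beta^2)$ for $\beta<1$ (and $\lambda=+\infty$ for $\beta\ge1$). *)

(* Defs.v *)
From HB Require Import structures.
From mathcomp Require Import all_boot all_order all_algebra finmap.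
From mathcomp Require Import all_classical all_reals all_analysis measurable_realfun.

Set Implicit Arguments.
Unset Strict Implicit.
Unset Printing Implicit Defensive.

Import Order.TTheory GRing.Theory Num.Theory.
Import numFieldNormedType.Exports.

Local Open Scope classical_set_scope.
Local Open Scope ring_scope.

Notation lattice d := 'rV[int]_d.

(** * Independence *)

Definition mutual_independence {T : Type} {R : realType}
    (P : set T -> \bar R) {I : choiceType} (F : I -> set (set T)) : Prop :=
  forall (K : {fset I}) (A : I -> set T),
    (forall i, i \in K -> F i (A i)) ->
    P (\bigcap_(i in [set` K]) A i) = (\prod_(i <- K) P (A i))%E.

Definition sigma_of_process {dT} {T : measurableType dT} {R : realType}
    {I : Type} (Y : I -> T -> R) : set (set T) :=
  <<s \bigcup_i g_sigma_algebra_preimage (Y i) >>.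

(** * The environment *)

Definition two_sided_wiener {dT} {T : measurableType dT} {R : realType}
    (P : set T -> \bar R) (B : R -> T -> R) : Prop :=
  [/\ forall w, B 0 w = 0,
      forall w, continuous (B ^~ w),
      forall t, measurable_fun setT (B t),
      (* the second parameter of normal_prob is the standard deviation *)
      forall u v, u < v -> forall A, measurable A ->
        P [set w | A (B v w - B u w)] =
          normal_prob 0 (Num.sqrt (v - u)) A
    & forall (n : nat) (u : nat -> R),
        (forall i, (i < n)%N -> u i < u i.+1) ->
        mutual_independence P (fun i : 'I_n =>
          g_sigma_algebra_preimage (fun w => B (u i.+1) w - B (u i) w))].

Record environment (d : nat) (R : realType) : Type := Environment {
  env_fun :> lattice d -> R -> R ;
  env_continuous : forall x, continuous (env_fun x) ;
  env0 : forall x, env_fun x 0 = 0 }.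

Section environment_pointed.
Context (d : nat) (R : realType).

Definition zero_environment : environment d R :=
  @Environment d R (fun _ _ => 0) (fun _ => @cst_continuous R R 0)
    (fun _ => erefl).

HB.instance Definition _ := gen_eqMixin (environment d R).
HB.instance Definition _ := gen_choiceMixin (environment d R).
HB.instance Definition _ :=
  isPointed.Build (environment d R) zero_environment.

End environment_pointed.

Definition env_coord {d : nat} {R : realType} (x : lattice d) (t : R)
  (w : environment d R) : R := w x t.

Definition coord_preimages (d : nat) (R : realType) :
    set (set (environment d R)) :=
  \bigcup_(x : lattice d) \bigcup_(t : R)
    g_sigma_algebra_preimage (env_coord x t).
Arguments coord_preimages : clear implicits.

Notation path_space d R := (g_sigma_algebraType (coord_preimages d R)).

Definition wiener_environment {d : nat} {R : realType}
    (Q0 : probability (path_space d R) R) : Prop :=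
  (forall x : lattice d, two_sided_wiener Q0 (env_coord x)) /\
  mutual_independence Q0 (fun x : lattice d =>
    sigma_of_process (env_coord x : R -> path_space d R -> R)).

(** * The random walk *)

Definition unit_step {d : nat} (i : 'I_d) (b : bool) : lattice d :=
  (-1) ^+ b *: delta_mx 0 i.

Definition npoints {R : realType} (B : set R) (J : nat -> R) : \bar R :=
  counting [set k | B (J k)].

(* Poisson point process of rate 1 on ]0, +oo[, whose points are enumerated in
   increasing order. *)
Record poisson_process {dT} {T : measurableType dT} {R : realType}
    (P : probability T R) (J : nat -> T -> R) : Prop := {
  poisson_measurable : forall k, measurable_fun setT (J k) ;
  poisson_gt0 : forall w, 0 < J 0%N w ;
  poisson_increasing : forall w k, J k w < J k.+1 w ;
  poisson_unbounded : forall w, J ^~ w @ \oo --> +oo ;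
  (* the second argument of poisson_prob is a dummy *)
  poisson_count : forall B : set R, measurable B -> B `<=` `]0, +oo[ ->
    (lebesgue_measure B < +oo)%E -> forall n : nat,
    P [set w | npoints B (J ^~ w) = n%:R%:E] =
      poisson_prob (fine (lebesgue_measure B)) 0%N [set n] ;
  poisson_independent : forall (n : nat) (B : 'I_n -> set R),
    (forall i, measurable (B i) /\ B i `<=` `]0, +oo[) ->
    trivIset setT B ->
    mutual_independence P (fun i =>
      g_sigma_algebra_preimage (fun w => npoints (B i) (J ^~ w))) }.

(* J k is the time elapsed from the start to the (k+1)-st jump and X k is the
   displacement of that jump; the sigma-algebra on the lattice is discrete. *)
Record simple_random_walk {d : nat} {dT} {T : measurableType dT} {R : realType}
    (P : probability T R) (J : nat -> T -> R) (X : nat -> T -> lattice d) :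
    Prop := {
  walk_jump_times : poisson_process P J ;
  walk_step_measurable : forall k (A : set (lattice d)),
    measurable (X k @^-1` A) ;
  walk_step_uniform : forall k (i : 'I_d) (b : bool),
    P (X k @^-1` [set unit_step i b]) = ((2 * d)%:R^-1)%:E ;
  walk_independent : mutual_independence P (fun o : option nat =>
    if o is Some k then preimage_set_system setT (X k) setT
    else sigma_of_process J) }.

Definition site {d : nat} (x : lattice d) (X : nat -> lattice d) (k : nat) :
  lattice d := x + \sum_(i < k) X i.

Section walk.
Context (d : nat) {dT : measure_display} (T : measurableType dT) (R : realType).
Variables (P : probability T R) (J : nat -> T -> R) (X : nat -> T -> lattice d).

(* Under P_{x,s} the walk jumps at the times s + J k; translates of a Poisson
   process being Poisson, all the laws P_{x,s} live on the same space (T, P). *)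
Definition eta (x : lattice d) (s t : R) (w : T) : lattice d :=
  site x (X ^~ w) #|` fset_set [set k | s + J k w <= t] |.

Definition walk_prob (t : R) (z : lattice d) : R :=
  fine (P [set w | eta 0 0 t w = z]).

Definition bridge_expectation (x : lattice d) (s : R) (y : lattice d) (t : R)
    (f : T -> \bar R) : \bar R :=
  ((\int[P]_(w in [set w | eta x s t w = y]) f w) *
   (fine (P [set w | eta x s t w = y]))^-1%:E)%E.

(* only the jumps in ]s, t[ enter the action over [s, t[, whereas the
   right-continuous walk eta counts a jump at time t as already made *)
Definition path_action (x : lattice d) (s t : R)
    (omega : environment d R) (w : T) : R :=
  let n := #|` fset_set [set k | s + J k w < t] | in
  let time j :=
    if j is k.+1 then (if (k < n)%N then s + J k w else t) else s in
  let gamma := site x (X ^~ w) in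
  \sum_(j < n.+1) (omega (gamma j) (time j.+1) - omega (gamma j) (time j)).

Variable beta : R.

Definition Zpoint (x : lattice d) (s : R) (y : lattice d) (t : R)
    (omega : environment d R) : \bar R :=
  ((expR (- (beta ^+ 2 / 2) * (t - s)) * walk_prob (t - s) (y - x))%:E *
   bridge_expectation x s y t
     (fun w => (expR (beta * path_action x s t omega w))%:E))%E.

Definition Zline (x : lattice d) (s t : R) (omega : environment d R) : \bar R :=
  (\esum_(y in [set: lattice d]) Zpoint x s y t omega)%E.

End walk.

(** * The constants *)

Fixpoint srw_transition (R : realType) (d n : nat) (z : lattice d) : R :=
  if n is m.+1 then
    (2 * d)%:R^-1 *
    \sum_(i < d) \sum_(b : bool) srw_transition R m (z - unit_step i b)
  else (z == 0)%:R.

Definition alpha (R : realType) (d : nat) : \bar R :=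
  (\sum_(1 <= n <oo)
     \esum_(z in [set: lattice d]) ((srw_transition R n z) ^+ 2)%:E)%E.

Definition lambda {R : realType} (beta : R) : \bar R :=
  (\int[exponential_prob (1 : R)]_tau (expR (beta ^+ 2 * tau) - 1)%:E)%E.

(** * Mean-square convergence *)

Definition in_L2 {dT} {T : measurableType dT} {R : realType}
    (mu : {measure set T -> \bar R}) (f : T -> \bar R) : Prop :=
  measurable_fun setT f /\ ('N[mu]_2%:E[f] < +oo)%E.

(* convergence in L^2 as t --> +oo of a family indexed by times t > s, to a
   real-valued limit *)
Definition cvg_L2 {dT} {T : measurableType dT} {R : realType}
    (mu : {measure set T -> \bar R}) (s : R) (f : R -> T -> \bar R)
    (g : T -> R) : Prop :=
  [/\ forall t, s < t -> in_L2 mu (f t),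
      in_L2 mu (EFin \o g)
    & ('N[mu]_2%:E[(fun w => f t w - (g w)%:E)] @[t --> +oo%R] --> 0)%E].

(* Main.v *)
Require Import Defs.
From HB Require Import structures.
From mathcomp Require Import all_boot all_order all_algebra finmap.
From mathcomp Require Import all_classical all_reals all_analysis measurable_realfun.
From mathcomp Require Import lra ring zify.

Set Implicit Arguments.
Unset Strict Implicit.
Unset Printing Implicit Defensive.

Import Order.TTheory GRing.Theory Num.Theory.
Import numFieldNormedType.Exports.

Local Open Scope classical_set_scope.
Local Open Scope ring_scope.

(** The theorem is a second moment computation. Summing the partition functions
    over the endpoint undoes the conditioning, so that Z_t is the average over the
    walk of the weight exp (beta A_t - beta^2 (t - s) / 2), where A_t is the action
    (Zline_integral). By Tonelli, the correlation of Z_t and Z_u is an average over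
    two independent walks of a Gaussian integral. Increments of the environment at
    distinct sites or over disjoint time intervals are independent, so the Gaussian
    integral equals exp (beta^2 L), where L is the time that the two walks spend
    together before time min t u (environment_boxes_mgf, pair_correlationE).
    Hence the correlation of Z_t and Z_u is M (min t u) for one nondecreasing
    function M, and Z_t - Z_u has second moment |M t - M u|. The family is therefore
    Cauchy in mean square as soon as M is bounded (mean_square_limit).

    The bound on M is an exponential moment bound for the time spent together. For
    two walks observed only at the multiples of a mesh h, the exponential becomes
    the product over i of 1 + c 1(the walks meet at time i h), with
    c = exp (beta^2 h) - 1. Expand this product according to its first factor that
    is not 1. After a meeting the difference of the walks starts afresh from 0, so
    the means H_m of these products satisfy
      H_m = 1 + c sum_(1 <= i <= m) P (the walks meet at time i h) H_(m - i),
    and they are at most 1 / (1 - theta) if c times the expected number of meetings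
    is at most theta < 1 (khasminskii). The walks meet at time r with probability
    sum_z p_r(z)^2. As p_r is the mixture of the q_n with Poisson weights, convexity
    bounds this by sum_n pois_r(n) sum_z q_n(z)^2. Moreover h sum_i pois_(i h)(n) is
    at most e^h, since it is essentially a Riemann sum of a Gamma density. The
    expected number of meetings is thus at most e^h (1 + alpha_d) / h
    (expected_collisions), and c times this bound tends to beta^2 (1 + alpha_d) as h
    tends to 0. Since lambda = beta^2 / (1 - beta^2) for beta < 1 and alpha_d > 0,
    the hypothesis alpha_d lambda < 1 forces beta^2 (1 + alpha_d) < 1
    (small_disorder). Fatou's lemma along h -> 0 yields a bound on M that does not
    depend on time (pair_correlation_bounded).

    The independence of the pieces of the walk that the renewal argument needs is
    skeleton_law: the increments of the walk between prescribed times are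
    independent with laws p_r. It is deduced from the counts of the Poisson process
    and from the independence of the steps from the jump times. *)

(** * Mean-square limits of families with correlations M (min t u) *)

(** This form of Fatou's lemma serves both for the distances to the members of a
    sequence, whose integrals are known, and for truncated exponentials, whose
    integrals are only bounded. *)
Lemma ae_fatou {d} {T : measurableType d} {R : realType}
    (mu : {measure set T -> \bar R}) (h : T -> \bar R) (u : nat -> T -> \bar R)
    (c : nat -> \bar R) (l : \bar R) :
  measurable_fun setT h -> (forall k, measurable_fun setT (u k)) ->
  (forall k w, 0 <= u k w)%E ->
  {ae mu, forall w, u k w @[k --> \oo] --> h w} ->
  (forall k, \int[mu]_w u k w <= c k)%E -> c @ \oo --> l ->
  (\int[mu]_w h w <= l)%E.
Proof.
move=> mh mu_ u0 uh uc cl.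
have -> : (\int[mu]_w h w = \int[mu]_w limn_einf (u ^~ w))%E.
  apply: ae_eq_integral => //.
  - have -> : (fun w => limn_einf (u ^~ w)) =
        (fun w => - limn_esup (fun k => - u k w))%E.
      by apply/funext => w; rewrite -limn_einfN; congr limn_einf;
        apply/funext => k /=; rewrite oppeK.
    apply: measurableT_comp => //; apply: measurable_fun_limn_esup => k.
    exact: measurableT_comp.
  - by apply: filterS uh => w uw _; rewrite (cvg_limn_einf_sup uw).1.
apply: (le_trans (fatou _ _ _ _)) => //.
rewrite limn_einf_lim -(cvg_lim _ cl)//; apply: lee_lim.
- exact: is_cvg_einfs.
- by apply/cvg_ex; exists l.
- apply: nearW => n; apply: le_trans (uc n).
  by apply: ereal_inf_lbound; exists n => /=.
Qed.

(** By the inequality of arithmetic and geometric means,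
    |x| <= 2 ^- (k + 1) + 2 ^ k x ^ 2 / 2, so the increments are absolutely summable. *)
Lemma cvgn_weighted_increments {R : realType} (a : nat -> R) :
  (\sum_(k <oo) (2 ^+ k * (a k.+1 - a k) ^+ 2)%:E < +oo)%E -> cvgn a.
Proof.
move=> Dfin.
set D := fun k => 2 ^+ k * (a k.+1 - a k) ^+ 2.
have D0 k : 0 <= D k by apply: mulr_ge0; rewrite ?sqr_ge0 ?exprn_ge0.
have -> : a = (fun n => a 0%N + series (telescope a) n).
  by apply/funext => n; exact: eq_sum_telescope.
apply: is_cvgD; first exact: is_cvg_cst.
apply: (@normed_cvg _ R^o); apply: nondecreasing_is_cvgn.
  apply: nondecreasing_series => k _ _; exact: normr_ge0.
set S := fine (\sum_(k <oo) (D k)%:E)%E.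
exists (1 + S / 2) => _ [n _ <-].
apply: (@le_trans _ _ (\sum_(0 <= k < n) ((2^-1) ^+ k.+1 + D k / 2))).
  rewrite /series/=; apply: ler_sum => k _; rewrite /D/= /telescope.
  set x := a k.+1 - a k; set y : R := 2 ^+ k.
  have y0 : 0 < y by rewrite exprn_gt0.
  rewrite exprS exprVn -/y -(@ler_pM2l _ y)//.
  have -> : y * (2^-1 * y^-1 + y * x ^+ 2 / 2) = (1 + (y * x) ^+ 2) / 2.
    by field; exact: lt0r_neq0.
  rewrite -{1}(gtr0_norm y0) -normrM -(real_normK (num_real (y * x))).
  have := sqr_ge0 (`|y * x| - 1); nra.
rewrite big_split/=; apply: lerD.
  have -> : \sum_(0 <= k < n) (2^-1 : R) ^+ k.+1 =
      series (geometric 2^-1 2^-1) n.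
    by rewrite /series/=; apply: eq_bigr => k _; rewrite exprS.
  have h0 : 0 < (2^-1 : R) by lra.
  have h1 : `|2^-1 : R| < 1 by rewrite gtr0_norm//; lra.
  apply: (le_trans (geometric_le_lim n (ltW h0) h0 h1)).
  have -> : (1 - 2^-1 : R) = 2^-1 by lra.
  by rewrite divff// lt0r_neq0.
rewrite -big_distrl/= ler_pM2r//.
rewrite -lee_fin /S fineK; last first.
  by rewrite ge0_fin_numE//; apply: nneseries_ge0 => k _ _; rewrite lee_fin.
rewrite -sumEFin; apply: nneseries_lim_ge => k _ _; by rewrite lee_fin.
Qed.

Section mean_square_limit.
Context {dT} {T : measurableType dT} {R : realType}.
Variables (mu : {measure set T -> \bar R}) (s : R) (f : R -> T -> \bar R).
Variables (M : R -> R) (C : R).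
Hypothesis mf : forall t, s < t -> measurable_fun setT (f t).
Hypothesis f_ge0 : forall t w, s < t -> (0 <= f t w)%E.
Hypothesis intff : forall t u, s < t -> s < u ->
  (\int[mu]_w (f t w * f u w) = (M (Num.min t u))%:E)%E.
Hypothesis M_nd : forall t u, s < t -> t <= u -> M t <= M u.
Hypothesis M_ub : forall t, s < t -> M t <= C.

Let z t w := fine (f t w).

Let mz t : s < t -> measurable_fun setT (z t).
Proof. by move=> st; apply: measurableT_comp => //; exact: mf. Qed.

Let z_ge0 t w : s < t -> 0 <= z t w.
Proof. by move=> st; apply: fine_ge0; exact: f_ge0. Qed.

Let f_fin t : s < t -> {ae mu, forall w, (z t w)%:E = f t w}.
Proof.
move=> st.
have : mu.-integrable setT (fun w => f t w * f t w)%E.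
  apply/integrableP; split; first by apply: emeasurable_funM; exact: mf.
  under eq_integral => w _ do rewrite gee0_abs ?mule_ge0 ?f_ge0//.
  by rewrite intff// minxx ltry.
move=> /(integrable_ae measurableT).
apply: filterS => w /(_ I); rewrite /z.
have := f_ge0 w st; case: (f t w) => [r//| |//] _.
by rewrite mulyy.
Qed.

Let intzz t u : s < t -> s < u ->
  (\int[mu]_w (z t w * z u w)%:E = (M (Num.min t u))%:E)%E.
Proof.
move=> st su; rewrite -intff//; apply: ge0_ae_eq_integral => //.
- by apply/measurable_EFinP; apply: measurable_funM; exact: mz.
- by apply: emeasurable_funM; exact: mf.
- by move=> w _; rewrite lee_fin mulr_ge0 ?z_ge0.
- by move=> w _; rewrite mule_ge0 ?f_ge0.
- near=> w => _; rewrite EFinM.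
  by congr (_ * _)%E; near: w; exact: f_fin.
Unshelve. all: by end_near. Qed.

Let intzB t u : s < t -> s < u ->
  (\int[mu]_w ((z t w - z u w) ^+ 2)%:E = `|M t - M u|%:E)%E.
Proof.
move=> st su.
have mB : measurable_fun setT (fun w => ((z t w - z u w) ^+ 2)%:E).
  apply/measurable_EFinP/measurable_funX/measurable_funB; exact: mz.
have mM a b : s < a -> s < b -> measurable_fun setT (fun w => (z a w * z b w)%:E).
  by move=> sa sb; apply/measurable_EFinP/measurable_funM; exact: mz.
have z0 a b w : s < a -> s < b -> (0 <= (z a w * z b w)%:E)%E.
  by move=> sa sb; rewrite lee_fin mulr_ge0 ?z_ge0.
have : (\int[mu]_w (((z t w - z u w) ^+ 2)%:E + (2%:E * (z t w * z u w)%:E)) =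
        \int[mu]_w ((z t w * z t w)%:E + (z u w * z u w)%:E))%E.
  by apply: eq_integral => w _; rewrite -EFinM -!EFinD; congr EFin; ring.
rewrite ge0_integralD//; last 3 first.
- by move=> w _; rewrite lee_fin sqr_ge0.
- by move=> w _; rewrite mule_ge0 ?z0.
- by apply: measurable_funeM; exact: mM.
rewrite ge0_integralZl_EFin//; last 2 first.
- by move=> w _; rewrite z0.
- exact: mM.
rewrite ge0_integralD//; [|by move=> w _; rewrite z0|exact: mM
  |by move=> w _; rewrite z0|exact: mM].
rewrite !intzz// !minxx.
have := @integral_ge0 _ _ _ mu setT (fun w => ((z t w - z u w) ^+ 2)%:E)
  (fun w _ => sqr_ge0 _).
case: (\int[mu]_w _)%E => [r| |] // r0.
rewrite -!EFinM -!EFinD => -[H]; congr EFin.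
have [tu|/ltW ut] := leP t u.
  by rewrite min_l// in H *; rewrite distrC ger0_norm ?subr_ge0 ?M_nd//; lra.
by rewrite min_r// in H *; rewrite ger0_norm ?subr_ge0 ?M_nd//; lra.
Qed.

Let M_cvg : exists l : R, (forall t, s < t -> M t <= l) /\
  (forall e : R, 0 < e -> exists2 t, s < t & forall u, t <= u -> l - M u <= e).
Proof.
pose A := [set M t | t in [set t | s < t]].
have supA : has_sup A.
  split; first by exists (M (s + 1)), (s + 1) => //=; lra.
  by exists C => _ [t st <-]; exact: M_ub.
exists (sup A); split.
  by move=> t st; apply: ub_le_sup => //; [case: supA|exists t].
move=> e e0; have [_ [t st <-] H] := sup_adherent e0 supA.
by exists t => // u tu; have := M_nd st tu; lra.
Qed.

Lemma Lnorm2_ae_eq (h : T -> \bar R) (k : T -> R) : measurable_fun setT h ->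
  measurable_fun setT k -> {ae mu, forall w, h w = (k w)%:E} ->
  ('N[mu]_2%:E[h] = sqrte (\int[mu]_w ((k w) ^+ 2)%:E))%E.
Proof.
move=> mh mk hk; rewrite unlock poweR12_sqrt; last first.
  by apply: integral_ge0 => w _; exact: poweR_ge0.
congr sqrte; apply: ge0_ae_eq_integral => //.
- apply: (measurableT_comp (measurable_poweR _)); exact: measurableT_comp.
- by apply/measurable_EFinP/measurable_funX.
- by move=> w _; exact: poweR_ge0.
- by move=> w _; rewrite lee_fin sqr_ge0.
- apply: filterS hk => w -> _; rewrite /= powR_mulrn ?normr_ge0//.
  by rewrite real_normK ?num_real.
Qed.

(** The family is Cauchy in mean square, because f t - f u has second moment
    |M t - M u|. The limit is obtained pointwise along a sequence tau on which the
    increments of M are so small that cvgn_weighted_increments applies almost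
    everywhere; the distance from f t to the limit is then estimated by Fatou's
    lemma. *)
Lemma mean_square_limit : exists g : T -> R, cvg_L2 mu s f g.
Proof.
have [l [Ml Me]] := M_cvg.
(* the gaps are small enough for 2 ^ k |M (tau (k + 1)) - M (tau k)| to be summable *)
have /choice[tau Htau] : forall k, exists t, s < t /\ l - M t <= 8^-1 ^+ k.+1.
  move=> k; have [|t st /(_ t (lexx _))] := Me (8^-1 ^+ k.+1).
    by rewrite exprn_gt0.
  by exists t.
have stau k : s < tau k by have [] := Htau k.
(* the upper limit makes g measurable even where the sequence diverges *)
pose g w := fine (limn_esup (fun k => (z (tau k) w)%:E)).
have mg : measurable_fun setT g.
  apply: measurableT_comp => //; apply: measurable_fun_limn_esup => k.
  by apply/measurable_EFinP; exact: mz.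
have zcvg : {ae mu, forall w, z (tau k) w @[k --> \oo] --> g w}.
  pose D k w := (2 ^+ k * (z (tau k.+1) w - z (tau k) w) ^+ 2)%:E.
  have mD k : measurable_fun setT (D k).
    apply/measurable_EFinP/measurable_funM => //.
    by apply/measurable_funX/measurable_funB; exact: mz.
  have D0 k w : (0 <= D k w)%E.
    by rewrite lee_fin; apply: mulr_ge0; rewrite ?sqr_ge0 ?exprn_ge0.
  have intD k : (\int[mu]_w D k w <= (1 / (2 ^ k.+1)%:R)%:E)%E.
    under eq_integral do rewrite /D EFinM.
    rewrite ge0_integralZl_EFin//; last 2 first.
    - by move=> w _; rewrite lee_fin sqr_ge0.
    - by apply/measurable_EFinP/measurable_funX/measurable_funB; exact: mz.
    rewrite intzB// -EFinM lee_fin.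
    have [_ H0] := Htau k; have [_ H1] := Htau k.+1.
    have H2 := Ml _ (stau k); have H3 := Ml _ (stau k.+1).
    have H4 : 8^-1 ^+ k.+2 <= (8^-1 : R) ^+ k.+1.
      by rewrite (exprS _ k.+1) ler_piMl ?exprn_ge0//; lra.
    have : `|M (tau k.+1) - M (tau k)| <= 8^-1 ^+ k.+1.
      by rewrite ler_norml; apply/andP; split; lra.
    move=> /(ler_wpM2l (exprn_ge0 k (ler0n R 2))) /le_trans; apply.
    rewrite natrX div1r -exprVn exprS mulrCA -exprMn.
    have -> : (2 * 8^-1 : R) = 2^-1 * 2^-1 by lra.
    rewrite exprMn exprS.
    have p0 : 0 < (2^-1 : R) ^+ k by rewrite exprn_gt0.
    have p1 : (2^-1 : R) ^+ k <= 1 by rewrite exprn_ile1//; lra.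
    nra.
  have : mu.-integrable setT (fun w => \sum_(k <oo) D k w)%E.
    apply/integrableP; split.
      by apply: ge0_emeasurable_sum => // k w _ _; exact: D0.
    under eq_integral => w _ do rewrite gee0_abs ?nneseries_ge0//.
    rewrite integral_nneseries//.
    apply: (@le_lt_trans _ _ (\sum_(k <oo) (1 / (2 ^ k.+1)%:R)%:E)%E).
      apply: lee_nneseries => // k _ ?; exact: integral_ge0.
    by apply: (le_lt_trans (epsilon_trick0 _ ler01)); rewrite ltry.
  move=> /(integrable_ae measurableT).
  apply: filterS => w /(_ I) wfin.
  have /cvg_ex[y zy] : cvgn (fun k => z (tau k) w).
    apply: cvgn_weighted_increments; move: wfin.
    by rewrite ge0_fin_numE// nneseries_ge0.
  rewrite /g.
  have zyE : (z (tau k) w)%:E @[k --> \oo] --> y%:E by apply/cvg_EFin => //; exact: nearW.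
  by rewrite (cvg_limn_einf_sup zyE).2.
have Mtau : M (tau k) @[k --> \oo] --> l.
  have g0 : (8^-1 : R) ^+ k.+1 @[k --> \oo] --> 0.
    rewrite (cvg_shiftS (fun k => (8^-1 : R) ^+ k)).
    by apply: cvg_expr; rewrite ger0_norm; lra.
  have : (l - 8^-1 ^+ k.+1) @[k --> \oo] --> l.
    by rewrite -[X in _ --> X]subr0; apply: cvgB => //; exact: cvg_cst.
  move=> H; apply: (squeeze_cvgr _ H (cvg_cst l)).
  near=> k; have [_ ?] := Htau k; apply/andP; split; first by lra.
  exact: Ml.
have intzg t : s < t -> (\int[mu]_w ((z t w - g w) ^+ 2)%:E <= `|M t - l|%:E)%E.
  move=> st.
  apply: (@ae_fatou _ _ _ _ _ (fun k w => ((z t w - z (tau k) w) ^+ 2)%:E)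
    (fun k => `|M t - M (tau k)|%:E)).
  - by apply/measurable_EFinP/measurable_funX/measurable_funB => //; exact: mz.
  - move=> k.
    by apply/measurable_EFinP/measurable_funX/measurable_funB => //; exact: mz.
  - by move=> k w; rewrite lee_fin sqr_ge0.
  - apply: filterS zcvg => w zw.
    apply/cvg_EFin; first exact: nearW.
    by apply: cvgM; apply: cvgB => //; exact: cvg_cst.
  - by move=> k; rewrite intzB.
  - apply/cvg_EFin; first exact: nearW.
    by apply: cvg_norm; apply: cvgB => //; exact: cvg_cst.
have intg : (\int[mu]_w ((g w) ^+ 2)%:E <= l%:E)%E.
  apply: (@ae_fatou _ _ _ _ _ (fun k w => ((z (tau k) w) ^+ 2)%:E)
    (fun k => (M (tau k))%:E)).
  - by apply/measurable_EFinP/measurable_funX.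
  - by move=> k; apply/measurable_EFinP/measurable_funX; exact: mz.
  - by move=> k w; rewrite lee_fin sqr_ge0.
  - apply: filterS zcvg => w zw; apply/cvg_EFin; first exact: nearW.
    exact: cvgM.
  - by move=> k; rewrite -[M _](congr1 M (minxx (tau k))) -intzz.
  - by apply/cvg_EFin; first exact: nearW.
exists g; split.
- move=> t st; split; first exact: mf.
  have -> : ('N[mu]_2%:E[f t] = sqrte (\int[mu]_w ((z t w) ^+ 2)%:E))%E.
    apply: Lnorm2_ae_eq; [exact: mf|exact: mz|].
    by apply: filterS (f_fin st) => w ->.
  by rewrite intzz// ltry.
- split; first exact/measurable_EFinP.
  have -> : ('N[mu]_2%:E[EFin \o g] = sqrte (\int[mu]_w ((g w) ^+ 2)%:E))%E.
    by apply: Lnorm2_ae_eq => //; [exact/measurable_EFinP|exact: aeW].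
  apply: (@le_lt_trans _ _ (sqrte l%:E)); last by rewrite ltry.
  rewrite lee_sqrt//; apply: le_trans intg.
  by apply: integral_ge0 => w _; rewrite lee_fin sqr_ge0.
- have N2 t : s < t ->
      ('N[mu]_2%:E[(fun w => f t w - (g w)%:E)] <= (Num.sqrt (`|M t - l|))%:E)%E.
    move=> st; rewrite (@Lnorm2_ae_eq _ (fun w => z t w - g w)); first last.
    + by apply: filterS (f_fin st) => w <-; rewrite EFinB.
    + by apply: measurable_funB => //; exact: mz.
    + apply: emeasurable_funB; [exact: mf|exact/measurable_EFinP].
    + by rewrite -[leRHS]/(sqrte _%:E) lee_sqrt ?intzg.
  apply: (@squeeze_cvge _ _ _ _ (cst 0%E) _
      (fun t => (Num.sqrt (`|M t - l|))%:E)).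
  + near=> t; rewrite Lnorm_ge0 N2//.
    by near: t; apply: nbhs_pinfty_gt; exact: num_real.
  + exact: cvg_cst.
  + apply/cvg_EFin; first exact: nearW.
    rewrite -[X in _ --> X](@sqrtr0 R); apply: continuous_cvg.
      exact: sqrt_continuous.
    rewrite -[X in _ --> X](@normr0 _ R); apply: cvg_norm.
    rewrite -[X in _ --> X](subrr l); apply: cvgB; last exact: cvg_cst.
    apply/cvgrPdist_le => e e0; have [t st H] := Me e e0.
    near=> u; have tu : t <= u by near: u; apply: nbhs_pinfty_ge; exact: num_real.
    by rewrite ger0_norm ?subr_ge0 ?Ml ?H//; exact: lt_le_trans tu.
Unshelve. all: by end_near. Qed.

End mean_square_limit.

(** * Integrals: completions, densities, independent functions *)

Lemma ge0_integral_law {d1 d2} {T : measurableType d1} {U : measurableType d2}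
    {R : realType} (mu : {measure set T -> \bar R})
    (nu : {measure set U -> \bar R}) (phi : T -> U) (f : U -> \bar R) :
  measurable_fun setT phi ->
  (forall A, measurable A -> mu (phi @^-1` A) = nu A) ->
  measurable_fun setT f -> (forall y, 0 <= f y)%E ->
  (\int[mu]_w f (phi w) = \int[nu]_y f y)%E.
Proof.
move=> mphi law mf f0.
have := @ge0_integral_pushforward _ _ _ _ R _ mphi mu setT _ measurableT mf.
rewrite preimage_setT => <- //.
by apply: (eq_measure_integral nu) => A mA _; exact: law.
Qed.

Section completion.
Context {d} {T : measurableType d} {R : realType}.
Variable mu : {measure set T -> \bar R}.
Let bmu := @completed_measure_extension d T R mu.

Lemma completed_measurable_fun (f : T -> \bar R) : measurable_fun setT f ->
  measurable_fun (setT : set (caratheodory_type (mu^*)%mu)) f.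
Proof.
move=> mf _ B mB; rewrite setTI.
have := mf measurableT B mB; rewrite setTI.
exact: caratheodory_measurable_mu_ext.
Qed.

(** The identity is measurable from the completion to the original space and
    carries one measure to the other. *)
Lemma completed_ge0_integral (f : T -> \bar R) : measurable_fun setT f ->
  (forall w, 0 <= f w)%E -> (\int[bmu]_w f w = \int[mu]_w f w)%E.
Proof.
move=> mf f0.
have mid : measurable_fun (setT : set (caratheodory_type (mu^*)%mu))
    (idfun : caratheodory_type (mu^*)%mu -> T).
  by move=> _ B mB; rewrite setTI; exact: caratheodory_measurable_mu_ext.
apply: (@ge0_integral_law _ _ _ _ _ bmu mu _ _ mid) => // A mA.
exact: measurable_mu_extE.
Qed.

End completion.

(** Tonelli applied to the region below the graph of f. It reduces statements
    about integrals against f to statements about the sets where f exceeds a level. *)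
Lemma layer_cake {d} {T : measurableType d} {R : realType}
    (P : {sigma_finite_measure set T -> \bar R}) (g : T -> \bar R) (f : T -> R) :
  measurable_fun setT g -> (forall w, 0 <= g w)%E ->
  measurable_fun setT f -> (forall w, 0 <= f w) ->
  (\int[P]_w (g w * (f w)%:E) =
   \int[lebesgue_measure]_(t in `[0%R : R, +oo[) \int[P]_(w in [set w | (t < f w)%R]) g w)%E.
Proof.
move=> mg g0 mf f0.
pose h (z : T * R) := (g z.1 * (((0 <= z.2) && (z.2 < f z.1))%:R)%:E)%E.
have mh : measurable_fun setT h.
  apply: emeasurable_funM; first exact: measurableT_comp.
  apply/measurable_EFinP.
  have -> : (fun z : T * R => ((0 <= z.2) && (z.2 < f z.1))%:R) =
      (\1_[set z : T * R | (0 <= z.2) && (z.2 < f z.1)] : _ -> R).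
    by apply/funext => z; rewrite indicE mem_setE.
  apply: measurable_indic.
  have mb : measurable_fun setT (fun z : T * R => (0 <= z.2) && (z.2 < f z.1)).
    apply: measurable_and; first by apply: measurable_fun_ler.
    by apply: measurable_fun_ltr => //; apply: measurableT_comp.
  by rewrite -[X in measurable X]setTI; exact: mb measurableT [set true] I.
have h0 z : (0 <= h z)%E by rewrite mule_ge0// lee_fin.
transitivity (\int[P]_w \int[lebesgue_measure]_t h (w, t))%E.
  apply: eq_integral => w _; rewrite /h/=.
  rewrite ge0_integralZl//; last first.
    apply/measurable_EFinP.
    have -> : (fun t : R => ((0 <= t) && (t < f w))%:R) =
        (\1_(`[0, f w[%classic) : R -> R).
      by apply/funext => t; rewrite indicE mem_setE in_itv/=.
    exact: measurable_indic.
  congr (_ * _)%E.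
  have -> : (fun t : R => (((0 <= t) && (t < f w))%:R)%:E) =
      (fun t => (\1_(`[0, f w[%classic) t)%:E) :> (R -> \bar R).
    by apply/funext => t; rewrite indicE mem_setE in_itv/=.
  rewrite integral_indic// setIT.
  have := lebesgue_measure_itv `[0, f w[; rewrite /= lte_fin => ->.
  have := f0 w; rewrite le_eqVlt => /predU1P[<-|->]; first by rewrite ltxx.
  by rewrite oppr0 adde0.
transitivity (\int[lebesgue_measure]_t \int[P]_w h (w, t))%E.
  exact: fubini_tonelli.
rewrite [RHS]integral_mkcond; apply: eq_integral => t _.
rewrite patchE; case: ifPn => [|]; rewrite mem_setE in_itv/= andbT => t0.
  rewrite [RHS]integral_mkcond; apply: eq_integral => w _.
  rewrite /h/= t0/= patchE.
  have [tf|tf] := boolP (t < f w); first by rewrite mem_set// mule1.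
  by rewrite memNset ?mule0//; exact/negP.
by apply: integral0_eq => w _; rewrite /h/= (negbTE t0) mule0.
Qed.

Lemma ge0_integral_density {d} {T : measurableType d} {R : realType}
    (mu nu : {sigma_finite_measure set T -> \bar R}) (p : T -> \bar R)
    (f : T -> R) :
  (forall A, measurable A -> nu A = \int[mu]_(x in A) p x)%E ->
  measurable_fun setT p -> (forall x, 0 <= p x)%E ->
  measurable_fun setT f -> (forall x, 0 <= f x) ->
  (\int[nu]_x (f x)%:E = \int[mu]_x (p x * (f x)%:E))%E.
Proof.
move=> nup mp p0 mf f0; rewrite layer_cake//.
under eq_integral do rewrite -[(f _)%:E]mul1e.
rewrite (@layer_cake _ _ _ nu (cst 1%E))//; apply: eq_integral => t _.
have mt : measurable [set x | t < f x].
  rewrite -[X in measurable X]setTI.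
  exact: (measurable_fun_ltr (measurable_cst t) mf) measurableT [set true] I.
by rewrite integral_cst// mul1e; exact: nup.
Qed.

Section tails.
Context {d} {T : measurableType d} {R : realType}.
Variable P : probability T R.

(** The hypothesis says that, up to the factor c, g is independent of the level
    sets of f. *)
Lemma integral_mul_of_tails (g : T -> \bar R) (f : T -> R) (c : R) :
  0 <= c ->
  measurable_fun setT g -> (forall w, 0 <= g w)%E ->
  measurable_fun setT f -> (forall w, 0 <= f w) ->
  (forall t, \int[P]_(w in [set w | (t < f w)%R]) g w =
     c%:E * P [set w | (t < f w)%R])%E ->
  (\int[P]_w (g w * (f w)%:E) = c%:E * \int[P]_w (f w)%:E)%E.
Proof.
move=> c0 mg g0 mf f0 gf; rewrite layer_cake//.
have -> : (\int[P]_w (f w)%:E = \int[P]_w (1 * (f w)%:E))%E.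
  by apply: eq_integral => w _; rewrite mul1e.
have mtail t : measurable [set w | (t < f w)%R].
  rewrite -[X in measurable X]setTI.
  exact: (measurable_fun_ltr (measurable_cst t) mf) measurableT [set true] I.
rewrite (@layer_cake _ _ _ P (cst 1%E))//.
rewrite -ge0_integralZl//; first 1 last.
- have -> : (fun t => \int[P]_(w in [set w | (t < f w)%R]) cst 1 w)%E =
      EFin \o (fun t => fine (P [set w | t < f w])).
    by apply/funext => t; rewrite integral_cst// mul1e /= fineK// fin_num_measure.
  apply/measurable_EFinP; apply: nonincreasing_measurable => // a b ab.
  apply: fine_le; rewrite ?fin_num_measure//.
  by apply: le_measure; rewrite ?inE//= => w /=; exact: le_lt_trans.
- by move=> t _; apply: integral_ge0.
by apply: eq_integral => t _; rewrite gf integral_cst// mul1e.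
Qed.
End tails.

Lemma mutual_independence_bigcap {T : Type} {R : realType}
    (P : set T -> \bar R) (I : choiceType) (F : I -> set (set T))
    (r : seq I) (A : I -> set T) :
  mutual_independence P F -> uniq r -> (forall i, i \in r -> F i (A i)) ->
  (P (\bigcap_(i in [set` r]) A i) = \prod_(i <- r) P (A i))%E.
Proof.
move=> indep r_uniq FA; pose K := [fset i in r]%fset.
have Kr : [set` K] = [set` r].
  by apply/seteqP; split => i /=; rewrite in_fset.
have := indep K A; rewrite Kr => ->; last by move=> i; rewrite in_fset => /FA.
by apply: perm_big; apply: uniq_perm => // i; rewrite in_fset.
Qed.

(** The factors are replaced by their integrals one at a time: the
    induction treats products of some of the f i with indicators of events of the
    others, and layer_cake trades f i for the indicators of its level sets. *)
Lemma mutual_independence_integral {d} {T : measurableType d} {R : realType}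
    (P : probability T R) (I : choiceType) (F : I -> set (set T))
    (f : I -> T -> R) (r : seq I) :
  mutual_independence P F -> uniq r ->
  (forall i, measurable_fun setT (f i)) -> (forall i w, 0 <= f i w) ->
  (forall i B, measurable B -> F i (f i @^-1` B)) ->
  (forall i, i \in r -> \int[P]_w (f i w)%:E < +oo)%E ->
  (\int[P]_w (\prod_(i <- r) f i w)%:E = \prod_(i <- r) \int[P]_w (f i w)%:E)%E.
Proof.
move=> indep r_uniq mf f0 fF ffin.
suff H : forall r1 (r2 : seq I) (A : I -> set T), uniq (r1 ++ r2) ->
    (forall i, i \in r1 -> \int[P]_w (f i w)%:E < +oo)%E ->
    (forall i, i \in r2 -> F i (A i) /\ measurable (A i)) ->
    (\int[P]_(w in \bigcap_(i in [set` r2]) A i) (\prod_(i <- r1) f i w)%:E =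
     (\prod_(i <- r1) \int[P]_w (f i w)%:E) * \prod_(i <- r2) P (A i))%E.
  have := H r [::] (fun=> setT).
  rewrite cats0 set_nil bigcap_set0 big_nil mule1; exact.
elim=> [|i r1 IH] r2 A /= u12 f1 FA.
  rewrite big_nil mul1e.
  under eq_integral do rewrite big_nil.
  rewrite integral_cst ?mul1e.
    by apply: (mutual_independence_bigcap indep) => // i /FA[].
  by apply: fin_bigcap_measurable => // i /FA[].
move: u12 => /andP[]; rewrite mem_cat negb_or => /andP[ir1 ir2] u12.
have f1' j : j \in r1 -> (\int[P]_w (f j w)%:E < +oo)%E.
  by move=> jr; apply: f1; rewrite inE jr orbT.
pose B := \bigcap_(i in [set` r2]) A i.
have mB : measurable B by apply: fin_bigcap_measurable => // j /FA[].
pose g w := ((\prod_(j <- r1) f j w)%:E * (\1_B w)%:E)%E.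
have mpr : measurable_fun setT (fun w => (\prod_(j <- r1) f j w)%:E).
  by apply/measurable_EFinP; apply: measurable_prod => j _.
have mg : measurable_fun setT g.
  apply: emeasurable_funM => //.
  exact/measurable_EFinP/measurable_indic.
have pr0 w : (0 <= (\prod_(j <- r1) f j w)%:E)%E.
  by rewrite lee_fin; apply: prodr_ge0.
have g0 w : (0 <= g w)%E by apply: mule_ge0; [exact: pr0|rewrite lee_fin indicE].
have fi0 j : (0 <= \int[P]_w (f j w)%:E)%E.
  by apply: integral_ge0 => w _; rewrite lee_fin.
pose c := ((\prod_(j <- r1) \int[P]_w (f j w)%:E) * \prod_(i <- r2) P (A i))%E.
have cfin : c \is a fin_num.
  rewrite fin_numM// big_seq prode_fin_num// => j jr.
    by rewrite ge0_fin_numE ?f1'.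
  by have [_ mAj] := FA j jr; exact: fin_num_measure.
have c0 : (0 <= c)%E by rewrite mule_ge0// prode_ge0.
transitivity (\int[P]_w (g w * (f i w)%:E))%E.
  rewrite integral_mkcond; apply: eq_integral => w _.
  rewrite patchE /g indicE big_cons EFinM muleC -/B.
  by case: ifPn => _; rewrite ?mule1 ?mule0 ?mul0e.
rewrite (@integral_mul_of_tails _ _ _ _ _ _ (fine c)) ?fine_ge0//.
  by rewrite fineK// big_cons /c muleC muleA.
move=> t; rewrite fineK//.
pose A' := fun j => if j == i then [set w | (t < f i w)%R] else A j.
have AA' : {in r2, A' =1 A}.
  by move=> j jr; rewrite /A'; case: eqP => // ji; rewrite -ji jr in ir2.
have mt : measurable [set w | (t < f i w)%R].
  rewrite -[X in measurable X]setTI.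
  exact: (measurable_fun_ltr (measurable_cst t) (mf i)) measurableT [set true]
    Logic.I.
have A'i : A' i = [set w | (t < f i w)%R] by rewrite /A' eqxx.
have := IH (i :: r2) A'.
rewrite uniq_catC /= mem_cat negb_or ir2 ir1 uniq_catC u12 => /(_ isT f1').
rewrite big_cons A'i [X in (_ * (_ * X))%E](eq_big_seq (P \o A)); last first.
  by move=> j jr /=; rewrite AA'.
have FA' : forall j, j \in i :: r2 -> F j (A' j) /\ measurable (A' j).
  move=> j; rewrite inE => /predU1P[->|jr]; last first.
    by rewrite AA'//; exact: FA.
  rewrite A'i; split => //.
  have := fF i `]t, +oo[%classic (measurable_itv _).
  by congr F; apply/seteqP; split => w; rewrite /= in_itv/= andbT.
move=> /(_ FA'); rewrite muleCA muleC => <-.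
rewrite integral_mkcond [RHS]integral_mkcond; apply: eq_integral => w _.
rewrite !patchE /g indicE.
have -> : (w \in \bigcap_(j in [set` i :: r2]) A' j) =
    (w \in [set w | (t < f i w)%R]) && (w \in B).
  apply/idP/andP; rewrite !inE.
    move=> H; split; first by have := H i; rewrite A'i; apply; rewrite /= inE eqxx.
    by move=> j /= jr; rewrite -AA'//; apply: H; rewrite /= inE jr orbT.
  move=> [H1 H2] j /=; rewrite inE => /predU1P[->|jr]; first by rewrite A'i.
  by rewrite AA'//; exact: H2.
by case: (w \in [set _ | _]); case: (w \in B); rewrite ?mule1 ?mule0.
Qed.

(** * Exponential moments of the environment *)

(** Completing the square turns the integrand into a multiple of the normal
    density with mean c sigma ^ 2. *)
Lemma normal_prob_mgf {R : realType} (sigma c : R) : sigma != 0 ->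
  (\int[normal_prob 0 sigma]_y (expR (c * y))%:E =
   (expR (c ^+ 2 * sigma ^+ 2 / 2))%:E)%E.
Proof.
move=> s0.
have mpdf m : measurable_fun setT (fun y : R => (normal_pdf m sigma y)%:E).
  by apply/measurable_EFinP; exact: measurable_normal_pdf.
have pdf0 m (y : R) : (0 <= (normal_pdf m sigma y)%:E)%E.
  by rewrite lee_fin normal_pdf_ge0.
rewrite (@ge0_integral_density _ _ _ lebesgue_measure _
  (fun y => (normal_pdf 0 sigma y)%:E))//; last first.
- exact: measurableT_comp.
- exact: mpdf.
transitivity (\int[lebesgue_measure]_y ((expR (c ^+ 2 * sigma ^+ 2 / 2))%:E *
    (normal_pdf (c * sigma ^+ 2) sigma y)%:E))%E.
  apply: eq_integral => y _.
  rewrite -!EFinM !normal_pdfE// /normal_fun mulrCA -!mulrA; congr EFin.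
  congr (_ * _); rewrite -!expRD; congr expR.
  by field.
rewrite ge0_integralZl_EFin ?expR_ge0//; last exact: mpdf.
by rewrite [X in (_ * X)%E]integral_normal_pdf mule1.
Qed.

Section wiener_mgf.
Context {d} {T : measurableType d} {R : realType}.
Variables (P : probability T R) (B : R -> T -> R).
Hypothesis BM : two_sided_wiener P B.

Lemma wiener_increment_mgf (u v c : R) : u < v ->
  (\int[P]_w (expR (c * (B v w - B u w)))%:E =
   (expR (c ^+ 2 * (v - u) / 2))%:E)%E.
Proof.
move=> uv; have [_ _ mB law _] := BM.
have mD : measurable_fun setT (fun w => B v w - B u w).
  by apply: measurable_funB.
have me : measurable_fun setT (fun y : R => (expR (c * y))%:E).
  by apply/measurable_EFinP; apply: measurableT_comp.
rewrite (@ge0_integral_law _ _ _ _ _ P (normal_prob 0 (Num.sqrt (v - u))) _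
  (fun y : R => (expR (c * y))%:E) mD)//; first last.
  by move=> A mA; exact: law.
rewrite normal_prob_mgf ?sqr_sqrtr ?subr_ge0 1?ltW//.
by rewrite gt_eqF// sqrtr_gt0 subr_gt0.
Qed.

(** The increments are independent, so the moment generating function is a
    product. *)
Lemma wiener_increments_mgf (n : nat) (u c : nat -> R) :
  (forall i, (i < n)%N -> u i < u i.+1) ->
  (\int[P]_w (expR (\sum_(i < n) c i * (B (u i.+1) w - B (u i) w)))%:E =
   (expR (\sum_(i < n) c i ^+ 2 * (u i.+1 - u i) / 2))%:E)%E.
Proof.
move=> u_incr; have [_ _ mB _ indep] := BM.
pose f (i : 'I_n) w := expR (c i * (B (u i.+1) w - B (u i) w)).
transitivity (\int[P]_w (\prod_(i <- index_enum 'I_n) f i w)%:E)%E.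
  by apply: eq_integral => w _; rewrite expR_sum.
rewrite (@mutual_independence_integral _ _ _ P _ _ f _ (indep n u u_incr)).
- rewrite expR_sum -prodEFin; apply: eq_bigr => i _.
  by rewrite /f wiener_increment_mgf// u_incr.
- exact: index_enum_uniq.
- move=> i; apply: measurableT_comp => //; apply: measurable_funM => //.
  exact: measurable_funB.
- by move=> i w; exact: expR_ge0.
- move=> i A mA; rewrite /g_sigma_algebra_preimage/= /preimage_set_system.
  exists ((fun y : R => expR (c i * y)) @^-1` A); last by rewrite setTI.
  rewrite -[X in measurable X]setTI.
  have me : measurable_fun setT (fun y : R => expR (c i * y)).
    exact: measurableT_comp.
  exact: me.
- by move=> i _; rewrite wiener_increment_mgf ?ltry// u_incr.
Qed.

End wiener_mgf.

Lemma sigma_of_process_measurable {dT} {T : measurableType dT} {R : realType}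
    {I : Type} (Y : I -> T -> R) (n : nat) (i : 'I_n -> I * I) (c : 'I_n -> R)
    (A : set R) :
  measurable A ->
  sigma_of_process Y ((fun w => expR (\sum_(k < n)
    c k * (Y (i k).2 w - Y (i k).1 w))) @^-1` A).
Proof.
move=> mA.
pose G := \bigcup_j g_sigma_algebra_preimage (Y j).
have mY j : measurable_fun (setT : set (g_sigma_algebraType G)) (Y j).
  move=> _ B mB; apply: sub_sigma_algebra; exists j => //.
  by exists B => //; rewrite setTI.
have mf : measurable_fun (setT : set (g_sigma_algebraType G)) (fun w => expR
    (\sum_(k < n) c k * (Y (i k).2 w - Y (i k).1 w))).
  apply: measurableT_comp => //; apply: measurable_sum => k.
  by apply: measurable_funM => //; apply: measurable_funB; exact: mY.
by have := mf measurableT A mA; rewrite setTI.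
Qed.

Section environment_mgf.
Context {d : nat} {R : realType} (Q : probability (path_space d R) R).
Hypothesis HQ : wiener_environment Q.

Lemma env_coord_measurable (z : lattice d) (t : R) :
  measurable_fun setT (env_coord z t : path_space d R -> R).
Proof. by have [/(_ z)[_ _ mB _ _] _] := HQ. Qed.

(** Along a common time grid, the Wiener processes attached to distinct sites are
    independent. *)
Lemma environment_increments_mgf (zs : seq (lattice d)) (n : nat)
    (u : nat -> R) (c : lattice d -> nat -> R) :
  uniq zs -> (forall i, (i < n)%N -> u i < u i.+1) ->
  (\int[Q]_om (expR (\sum_(z <- zs) \sum_(i < n)
      c z i * (om z (u i.+1) - om z (u i))))%:E =
   (expR (\sum_(z <- zs) \sum_(i < n)
      c z i ^+ 2 * (u i.+1 - u i) / 2))%:E)%E.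
Proof.
move=> zsu u_incr; have [BM indep] := HQ.
pose f (z : lattice d) (om : path_space d R) :=
  expR (\sum_(i < n) c z i * (env_coord z (u i.+1) om - env_coord z (u i) om)).
have fE z : (\int[Q]_om (f z om)%:E =
    (expR (\sum_(i < n) c z i ^+ 2 * (u i.+1 - u i) / 2))%:E)%E.
  exact: (wiener_increments_mgf (BM z)).
transitivity (\int[Q]_om (\prod_(z <- zs) f z om)%:E)%E.
  by apply: eq_integral => om _; rewrite expR_sum.
rewrite (@mutual_independence_integral _ _ _ Q _ _ f _ indep)//.
- by rewrite expR_sum -prodEFin; apply: eq_bigr => z _; exact: fE.
- move=> z; apply: measurableT_comp => //; apply: measurable_sum => k.
  apply: measurable_funM => //.
  by apply: measurable_funB; exact: env_coord_measurable.
- by move=> z om; exact: expR_ge0.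
- move=> z A mA.
  exact: (@sigma_of_process_measurable _ (path_space d R) R R (env_coord z) n
    (fun i : 'I_n => (u i, u i.+1)) (fun i : 'I_n => c z i) A mA).
- by move=> z _; rewrite fE ltry.
Qed.

Definition overlap (a b a' b' : R) : R :=
  Num.max 0 (Num.min b b' - Num.max a a').

Lemma sum_telescope_between (n : nat) (u F : nat -> R) (p q : nat) :
  {mono u : i j / (i <= j)%N >-> i <= j} -> (p <= q <= n)%N ->
  \sum_(i < n) ((u p <= u i) && (u i < u q))%:R * (F i.+1 - F i) = F q - F p.
Proof.
move=> um /andP[pq qn].
rewrite -(big_mkord xpredT (fun i =>
  ((u p <= u i) && (u i < u q))%:R * (F i.+1 - F i))).
rewrite (big_cat_nat (leq0n p) (leq_trans pq qn)) (big_cat_nat pq qn)/=.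
have ltE i j : (u i < u j) = (i < j)%N by rewrite ltNge um -ltnNge.
rewrite big_nat_cond big1 ?add0r; last first.
  by move=> i /andP[/andP[_ ip] _]; rewrite um leqNgt ip mul0r.
rewrite [X in _ + X]big_nat_cond [X in _ + X]big1 ?addr0; last first.
  by move=> i /andP[/andP[qi _] _]; rewrite ltE ltnNge qi andbF mul0r.
rewrite -telescope_sumr//; apply: eq_big_nat => i /andP[pi iq].
by rewrite um ltE pi iq mul1r.
Qed.

(** The boxes [a k, b k[ are cut along the sorted list of all their endpoints.
    On this grid the exponent is a linear combination of independent Gaussian
    increments. Expanding the square of its coefficients pairs the boxes, and two
    boxes of the same site contribute the length of their intersection. *)
Lemma environment_boxes_mgf (I : finType) (z : I -> lattice d) (a b : I -> R)
    (c : R) :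
  (forall k, a k <= b k) ->
  (\int[Q]_om (expR (c * \sum_k (om (z k) (b k) - om (z k) (a k))))%:E =
   (expR (c ^+ 2 / 2 * \sum_k \sum_l
      (z k == z l)%:R * overlap (a k) (b k) (a l) (b l)))%:E)%E.
Proof.
move=> ab.
pose U : seq R := sort <=%R (undup (map a (enum I) ++ map b (enum I))).
(* beyond the list U the grid goes on with steps 1, so as to be increasing on nat *)
pose u i := if (i < size U)%N then nth 0 U i
  else last 0 U + (i - size U).+1%:R.
pose n := (size U).-1.
have Us : sorted <%R U.
  by rewrite lt_sorted_uniq_le sort_uniq undup_uniq/= sort_le_sorted.
have aU k : a k \in U.
  by rewrite mem_sort mem_undup mem_cat map_f ?mem_enum.
have bU k : b k \in U.
  by rewrite mem_sort mem_undup mem_cat (map_f b) ?mem_enum ?orbT.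
have um : {mono u : i j / (i <= j)%N >-> i <= j}.
  have incr i : u i < u i.+1.
    rewrite /u; have [iU|Ui] := ltnP i.+1 (size U).
      by rewrite (ltnW iU) (lt_sorted_ltn_nth 0 Us)// inE ltnW.
    have [iU|Ui'] := ltnP i (size U).
      have -> : i.+1 = size U by apply/eqP; rewrite eqn_leq iU Ui.
      rewrite subnn -nth_last.
      have -> : i = (size U).-1 by rewrite -[i]/(i.+1.-1); congr predn; lia.
      by rewrite ltrDl ltr01.
    by rewrite ltrD2l ltr_nat; lia.
  exact/increasing_seqP.
have uE x : x \in U -> exists2 p, (p <= n)%N & x = u p.
  move=> xU; exists (index x U).
    by rewrite /n -ltnS prednK ?index_mem// (leq_ltn_trans _ (_ : (index x U < _)%N)) ?index_mem.
  by rewrite /u index_mem xU nth_index.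
have tele (F : R -> R) x y : x \in U -> y \in U -> x <= y ->
    \sum_(i < n) ((x <= u i) && (u i < y))%:R * (F (u i.+1) - F (u i)) =
    F y - F x.
  move=> /uE[p pn ->] /uE[q qn ->]; rewrite um => pq.
  by rewrite (@sum_telescope_between n u (F \o u))// pq.
pose ind k i : R := ((a k <= u i) && (u i < b k))%:R.
pose zs := undup (map z (enum I)).
(* the total coefficient of the increment of the site y over the cell i *)
pose cc y i := c * \sum_k (z k == y)%:R * ind k i.
have zsE (f : lattice d -> R) k : \sum_(y <- zs) (z k == y)%:R * f y = f (z k).
  have zk : z k \in zs by rewrite mem_undup map_f ?mem_enum.
  rewrite (bigD1_seq (z k)) ?undup_uniq//= eqxx mul1r big1 ?addr0// => y.
  by rewrite eq_sym => /negbTE ->; rewrite mul0r.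
transitivity (\int[Q]_om (expR (\sum_(y <- zs) \sum_(i < n)
      cc y i * (om y (u i.+1) - om y (u i))))%:E)%E.
  apply: eq_integral => om _; congr (EFin (expR _)).
  under [RHS]eq_bigr => y _ do rewrite /cc.
  transitivity (c * \sum_k \sum_(y <- zs) (z k == y)%:R *
      \sum_(i < n) ind k i * (om y (u i.+1) - om y (u i))).
    congr (_ * _); apply: eq_bigr => k _.
    by rewrite (zsE (fun y => \sum_(i < n) ind k i * (om y (u i.+1) - om y (u i)))) tele.
  rewrite exchange_big/= mulr_sumr; apply: eq_bigr => y _.
  under eq_bigr do rewrite mulr_sumr.
  rewrite exchange_big/= mulr_sumr; apply: eq_bigr => i _.
  by rewrite -mulrA mulr_suml; congr (_ * _); apply: eq_bigr => k _; ring.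
rewrite environment_increments_mgf ?undup_uniq//; last first.
  by move=> i _; rewrite ltNge um -ltnNge.
congr (EFin (expR _)).
transitivity (c ^+ 2 / 2 * \sum_k \sum_l \sum_(y <- zs) (z k == y)%:R *
   ((z l == y)%:R * \sum_(i < n) (ind k i * ind l i) * (u i.+1 - u i))).
  pose t y k l i := c ^+ 2 / 2 * ((z k == y)%:R * ((z l == y)%:R *
    (ind k i * ind l i * (u i.+1 - u i)))).
  transitivity (\sum_(y <- zs) \sum_(i < n) \sum_k \sum_l t y k l i).
    apply: eq_bigr => y _; apply: eq_bigr => i _.
    rewrite /cc; set S := \sum_k (z k == y)%:R * ind k i.
    transitivity (c ^+ 2 / 2 * (S * S * (u i.+1 - u i))); first by ring.
    rewrite /S big_distrlr/= mulr_suml mulr_sumr; apply: eq_bigr => k _.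
    rewrite mulr_suml mulr_sumr; apply: eq_bigr => l _.
    by rewrite /t; ring.
  transitivity (\sum_(y <- zs) \sum_k \sum_l \sum_(i < n) t y k l i).
    apply: eq_bigr => y _; rewrite exchange_big; apply: eq_bigr => k _ /=.
    by rewrite exchange_big.
  rewrite exchange_big/= mulr_sumr; apply: eq_bigr => k _.
  rewrite exchange_big/= mulr_sumr; apply: eq_bigr => l _.
  rewrite mulr_sumr; apply: eq_bigr => y _.
  by rewrite !mulr_sumr.
congr (_ * _); apply: eq_bigr => k _; apply: eq_bigr => l _.
rewrite (zsE (fun y => (z l == y)%:R * \sum_(i < n) ind k i * ind l i * (u i.+1 - u i))).
rewrite eq_sym; congr (_ * _); rewrite /overlap.
have mxU : Num.max (a k) (a l) \in U by rewrite maxEle; case: ifP.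
have mnU : Num.min (b k) (b l) \in U by rewrite minEle; case: ifP.
have indE i : ind k i * ind l i =
   ((Num.max (a k) (a l) <= u i) && (u i < Num.min (b k) (b l)))%:R.
  by rewrite /ind -natrM mulnb andbACA ge_max lt_min.
under eq_bigr do rewrite indE.
have [ab'|ab'] := leP (Num.max (a k) (a l)) (Num.min (b k) (b l)).
  by rewrite (tele idfun)// [RHS]max_r// subr_ge0.
rewrite [RHS]max_l; last by rewrite subr_le0 ltW.
rewrite big1// => i _.
have -> : (Num.max (a k) (a l) <= u i) && (u i < Num.min (b k) (b l)) = false.
  by apply/negP => /andP[/le_lt_trans h /h]; rewrite ltNge (ltW ab').
by rewrite mul0r.
Qed.

End environment_mgf.

(** * Countable fibres and the paths of the walk *)

Section countable_fibers.
Context {d} {T : measurableType d} {R : realType}.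

(** Measurability for the discrete sigma-algebra on a countable codomain. *)
Definition measurable_fibers {U : countType} (Y : T -> U) :=
  forall u, measurable (Y @^-1` [set u]).

Lemma measurable_fibers_preimage {U : countType} (Y : T -> U) (A : set U) :
  measurable_fibers Y -> measurable (Y @^-1` A).
Proof.
move=> mY.
have -> : Y @^-1` A = \bigcup_(u in A) (Y @^-1` [set u]).
  by apply/seteqP; split => [w Aw|w [u Au /= Yu]]; [exists (Y w)|rewrite /preimage/= Yu].
rewrite bigcup_mkcond; apply: countable_bigcupT_measurable => [|u].
  exact: countableP.
by case: ifP.
Qed.

Lemma measurable_fibers_pair {U V W : countType} (Y : T -> U) (Z : T -> V)
    (g : U -> V -> W) : measurable_fibers Y -> measurable_fibers Z ->
  measurable_fibers (fun w => g (Y w) (Z w)).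
Proof.
move=> mY mZ u.
have -> : (fun w => g (Y w) (Z w)) @^-1` [set u] =
    \bigcup_(a in [set: U]) (Y @^-1` [set a] `&` Z @^-1` [set b | g a b = u]).
  apply/seteqP; split => [w /= gu|w [a _ [/= <-]]//]; by exists (Y w).
apply: countable_bigcupT_measurable => [|a]; first exact: countableP.
by apply: measurableI => //; exact: measurable_fibers_preimage.
Qed.

Lemma measurable_fibers_index {U V : countType} (N : T -> U) (Y : U -> T -> V) :
  measurable_fibers N -> (forall u, measurable_fibers (Y u)) ->
  measurable_fibers (fun w => Y (N w) w).
Proof.
move=> mN mY v.
have -> : (fun w => Y (N w) w) @^-1` [set v] =
    \bigcup_(u in [set: U]) (N @^-1` [set u] `&` Y u @^-1` [set v]).
  apply/seteqP; split => [w /= gu|w [a _ [/= <-]]//]; by exists (N w).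
apply: countable_bigcupT_measurable => [|u]; first exact: countableP.
exact: measurableI (mN u) (mY u v).
Qed.

(** N takes the value n exactly if p (n - 1) holds and p n fails. *)
Lemma measurable_fibers_count (N : T -> nat) (p : nat -> T -> bool) :
  (forall k, measurable [set w | p k w]) ->
  (forall w k, p k w = (k < N w)%N) -> measurable_fibers N.
Proof.
move=> mp pN n.
have -> : N @^-1` [set n] =
    (if n is k.+1 then [set w | p k w] else setT) `&` ~` [set w | p n w].
  apply/seteqP; split => w /=.
    move=> <-; split; last by rewrite pN ltnn.
    by case: (N w) (pN w) => //= k ->.
  rewrite pN => -[H1 /negP]; rewrite -leqNgt => H2.
  apply/eqP; rewrite eqn_leq H2/=.
  by case: n H1 {H2} => //= k; rewrite pN.
by apply: measurableI; [case: n|exact: measurableC].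
Qed.

Lemma measurable_fun_fibers {d'} {V : measurableType d'} {U : countType}
    (Y : T -> U) (g : U -> T -> V) : measurable_fibers Y ->
  (forall u, measurable_fun setT (g u)) ->
  measurable_fun setT (fun w => g (Y w) w).
Proof.
move=> mY mg _ B mB; rewrite setTI.
have -> : (fun w => g (Y w) w) @^-1` B =
    \bigcup_(u in [set: U]) (Y @^-1` [set u] `&` g u @^-1` B).
  apply/seteqP; split => [w /= gu|w [a _ [/= <-]]//]; by exists (Y w).
apply: countable_bigcupT_measurable => [|u]; first exact: countableP.
apply: measurableI => //.
by rewrite -[X in measurable X]setTI; exact: mg.
Qed.

(** The fibres of Y form a countable measurable partition; they are enumerated
    through pickle. *)
Lemma esum_integral_fibers {U : countType} (mu : {measure set T -> \bar R})
    (Y : T -> U) (D : set T) (f : T -> \bar R) :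
  measurable_fibers Y -> measurable D ->
  measurable_fun setT f -> (forall w, 0 <= f w)%E ->
  (\esum_(y in [set: U]) \int[mu]_(w in D `&` (Y @^-1` [set y])) f w =
   \int[mu]_(w in D) f w)%E.
Proof.
move=> mY mD mf f0.
have inj_pickle : injective (@choice.pickle U).
  by move=> a b /(congr1 (@choice.unpickle U)); rewrite !choice.pickleK => -[].
pose F n := D `&` [set w | choice.pickle (Y w) = n].
have mF n : measurable (F n).
  apply: measurableI => //.
  exact: (@measurable_fibers_preimage _ _ [set u | choice.pickle u = n] mY).
have DF : D = \bigcup_n F n.
  by apply/seteqP; split => [w Dw|w [n _ []]//]; exists (choice.pickle (Y w)).
rewrite [in RHS]DF ge0_integral_bigcup//; last 2 first.
- exact: measurable_funS mf.
- by move=> i j _ _ [w [[_ /= <-] [_ /= <-]]].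
have F0 n : (0 <= \int[mu]_(w in F n) f w)%E by exact: integral_ge0.
rewrite nneseries_esumT//.
have -> : (\esum_(n in [set: nat]) \int[mu]_(w in F n) f w =
    \esum_(n in range (@choice.pickle U)) \int[mu]_(w in F n) f w)%E.
  rewrite [RHS]esum_mkcond; apply: eq_esum => n _; case: ifPn => //.
  rewrite notin_setE => nr.
  have -> : F n = set0.
    by rewrite -subset0 => w [_ /= wn]; apply: nr; exists (Y w).
  by rewrite integral_set0.
rewrite esum_image; last by move=> a b _ _; exact: inj_pickle.
apply: eq_esum => y _; congr (integral _ _ _); apply/seteqP; split => w [Dw] /=.
  by move=> <-.
by move=> /inj_pickle.
Qed.

Lemma esum_measure_fibers {U : countType} (mu : {measure set T -> \bar R})
    (Y : T -> U) (D : set T) :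
  measurable_fibers Y -> measurable D ->
  (\esum_(y in [set: U]) mu (D `&` (Y @^-1` [set y])) = mu D)%E.
Proof.
move=> mY mD; rewrite -[RHS]mul1e -integral_cst//.
rewrite -(@esum_integral_fibers _ _ Y)//; apply: eq_esum => y _.
by rewrite integral_cst ?mul1e//; exact: measurableI.
Qed.

End countable_fibers.

Section jump_counts.
Context {R : realType}.

Lemma card_fset_set_initial (A : set nat) (n : nat) :
  (forall k, A k <-> (k < n)%N) -> #|` fset_set A| = n.
Proof.
move=> An; have -> : A = `I_n by apply/seteqP; split => k /An.
exact: card_fset_set (card_eqxx _).
Qed.

Lemma initial_segment (p : nat -> bool) :
  (forall k, p k.+1 -> p k) -> (exists k, ~~ p k) ->
  exists n, forall k, p k = (k < n)%N.
Proof.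
move=> pS pN; exists (ex_minn pN) => k.
case: ex_minnP => n pn min_n; case: ltnP => kn.
  by apply/negPn/negP => /min_n; rewrite leqNgt kn.
apply/negbTE/negP => pk; move/negP : pn; apply.
elim: k kn pk => [|k IH]; first by rewrite leqn0 => /eqP ->.
by rewrite leq_eqVlt => /predU1P[-> //|nk /pS]; exact: IH.
Qed.

End jump_counts.

Section measurable_environment.
Context {d : nat} {R : realType} (Q : probability (path_space d R) R).
Hypothesis HQ : wiener_environment Q.

(** The environment is continuous in time, so it is the limit of its values at
    the time rounded down to multiples of 1 / (n + 1), which are countably many. *)
Lemma measurable_env_at (z : lattice d) :
  measurable_fun setT (fun p : path_space d R * R => env_coord z p.2 p.1).
Proof.
pose Y n (p : path_space d R * R) : int := Num.floor (p.2 * n.+1%:R).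
apply: (@measurable_fun_cvg _ _ _ _
    (fun n (p : path_space d R * R) =>
      env_coord z ((Y n p)%:~R / n.+1%:R) p.1)).
- move=> n; apply: (@measurable_fun_fibers _ _ _ _ _ (Y n)
    (fun m (p : path_space d R * R) => env_coord z (m%:~R / n.+1%:R) p.1)).
  + move=> m.
    have -> : Y n @^-1` [set m] = [set p | p.2 * n.+1%:R \in `[m%:~R, (m + 1)%:~R[].
      apply/seteqP; split => p; rewrite /= in_itv/= /Y.
        by move=> <-; rewrite floor_le_tmp floorD1_gt.
      by move=> /floor_def.
    have mp : measurable_fun setT (fun p : path_space d R * R => p.2 * n.+1%:R).
      by apply: measurable_funM => //; exact: measurable_snd.
    have := mp measurableT `[m%:~R, (m + 1)%:~R[%classic (measurable_itv _).
    by rewrite setTI.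
  + move=> m; apply: measurableT_comp; last exact: measurable_fst.
    exact: (env_coord_measurable HQ).
- move=> p _.
  have c : continuous ((p.1 : environment d R) z) :=
    @env_continuous d R p.1 z.
  apply: (@cvg_comp _ _ _ (fun n => (Y n p)%:~R / n.+1%:R : R)
    ((p.1 : environment d R) z) _ (nbhs p.2) _ _ (c p.2)).
  have h0 : p.2 - (n.+1%:R : R)^-1 @[n --> \oo] --> p.2.
    rewrite -[X in _ --> X]subr0; apply: cvgB; first exact: cvg_cst.
    exact: cvg_harmonic.
  apply: (squeeze_cvgr _ h0 (cvg_cst p.2)); apply: nearW => n.
  have n0 : 0 < (n.+1%:R : R) by rewrite ltr0n.
  rewrite ler_pdivrMr// ler_pdivlMr// mulrBl mulVf ?gt_eqF// /Y.
  have /andP[-> /ltW] := floor_itv (p.2 * n.+1%:R).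
  by rewrite andbT intrD lerBlDr.
Qed.

Lemma measurable_env_comp {d'} {T : measurableType d'} (Y : T -> lattice d)
    (tau : T -> R) : measurable_fibers Y -> measurable_fun setT tau ->
  measurable_fun setT (fun p : path_space d R * T =>
    env_coord (Y p.2) (tau p.2) p.1).
Proof.
move=> mY mtau.
apply: (@measurable_fun_fibers _ _ _ _ _ (fun p : path_space d R * T => Y p.2)
   (fun z (p : path_space d R * T) => env_coord z (tau p.2) p.1)).
  move=> z; rewrite -[X in measurable X]setTI.
  exact: measurable_snd measurableT _ (mY z).
move=> z.
apply: (measurableT_comp (measurable_env_at z)
  (_ : measurable_fun setT (fun p : path_space d R * T => (p.1, tau p.2)))).
apply: measurable_fun_pair; first exact: measurable_fst.
exact: measurableT_comp mtau measurable_snd.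
Qed.

End measurable_environment.

Section walk_paths.
Context {d : nat} {dT : measure_display} {T : measurableType dT} {R : realType}.
Variables (P : probability T R) (J : nat -> T -> R) (X : nat -> T -> lattice d).
Hypothesis hwalk : simple_random_walk P J X.

Let J_incr w k : J k w < J k.+1 w.
Proof. exact: (poisson_increasing (walk_jump_times hwalk)). Qed.

Lemma jump_time_gt0 k w : 0 < J k w.
Proof.
elim: k => [|k IH]; first exact: (poisson_gt0 (walk_jump_times hwalk)).
exact: lt_trans IH (J_incr w k).
Qed.

Lemma jump_time_unbounded w (r : R) : exists k, r < J k w.
Proof.
have /cvgryPgt/(_ r)[k _ H] := poisson_unbounded (walk_jump_times hwalk) w.
by exists k; exact: H (leqnn k).
Qed.

Lemma measurable_jump_time k : measurable_fun setT (J k).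
Proof. exact: (poisson_measurable (walk_jump_times hwalk)). Qed.

Definition njumps (r : R) (w : T) : nat := #|` fset_set [set k | J k w <= r]|.

Lemma njumpsP r w k : (J k w <= r) = (k < njumps r w)%N.
Proof.
have [||n Hn] := @initial_segment (fun k => J k w <= r).
- by move=> j /(le_trans (ltW (J_incr w j))).
- by have [j rj] := jump_time_unbounded w r; exists j; rewrite -ltNge.
by rewrite Hn /njumps (@card_fset_set_initial _ n)// => j; rewrite /= Hn.
Qed.

Lemma etaE x s t w : Defs.eta J X x s t w = site x (X ^~ w) (njumps (t - s) w).
Proof.
rewrite /Defs.eta /njumps; congr site; congr (#|` fset_set _|).
by apply/seteqP; split => k /=; rewrite lerBrDl.
Qed.

Lemma measurable_fibers_njumps r : measurable_fibers (njumps r).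
Proof.
apply: (@measurable_fibers_count _ _ _ (fun k w => J k w <= r)) => [k|w k].
  rewrite -[X in measurable X]setTI.
  exact: (measurable_fun_ler (measurable_jump_time k) (measurable_cst r))
    measurableT [set true] I.
exact: njumpsP.
Qed.

Lemma measurable_fibers_site x k :
  measurable_fibers (fun w => site x (X ^~ w) k).
Proof.
rewrite /site; elim: k => [|k IH] z.
  under eq_fun do rewrite big_ord0.
  by rewrite preimage_cst; case: ifP.
under eq_fun do rewrite big_ord_recr/= addrA.
apply: (@measurable_fibers_pair _ _ _ _ _ _ _ _ IH) => a.
exact: (walk_step_measurable hwalk).
Qed.

Lemma measurable_fibers_eta x s t : measurable_fibers (Defs.eta J X x s t).
Proof.
have -> : Defs.eta J X x s t = fun w => site x (X ^~ w) (njumps (t - s) w).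
  by apply/funext => w; exact: etaE.
apply: (@measurable_fibers_index _ _ _ _ (njumps (t - s))
  (fun n w => site x (X ^~ w) n)) => [|n].
  exact: measurable_fibers_njumps.
exact: measurable_fibers_site.
Qed.

Definition stopped_time (s t : R) (k : nat) (w : T) : R :=
  if k is k'.+1 then Num.min t (s + J k' w) else s.

(** Replacing the jump times by their minima with t makes all the terms after the
    last jump vanish, so that the random number of jumps can be replaced by any N with
    t <= s + J N w. *)
Lemma path_actionE x s t om w N : s < t -> t <= s + J N w ->
  path_action J X x s t om w =
  \sum_(k < N.+1) (om (site x (X ^~ w) k) (stopped_time s t k.+1 w) -
                   om (site x (X ^~ w) k) (stopped_time s t k w)).
Proof.
move=> st tN; rewrite /path_action.
have [||n Hn] := @initial_segment (fun k => s + J k w < t).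
- by move=> j; apply: lt_trans; rewrite ltrD2l.
- by exists N; rewrite -leNgt.
rewrite (@card_fset_set_initial _ n) => [|k]; last by rewrite /= Hn.
have nN : (n <= N)%N by rewrite leqNgt -Hn -leNgt.
have nN1 : (n.+1 <= N.+1)%N by [].
rewrite -(big_mkord xpredT (fun k => om (site x (X ^~ w) k)
  (stopped_time s t k.+1 w) - om (site x (X ^~ w) k) (stopped_time s t k w))).
rewrite (big_cat_nat (leq0n _) nN1)/= [X in _ + X]big_nat_cond.
rewrite [X in _ + X]big1 ?addr0; last first.
  move=> k /andP[/andP[nk _] _].
  have -> : Num.min t (s + J k w) = t by rewrite min_l// leNgt Hn -leqNgt ltnW.
  case: k nk => // k nk; rewrite /stopped_time min_l ?subrr//.
  by rewrite leNgt Hn -leqNgt.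
rewrite big_mkord; apply: eq_bigr => k _.
have timeE j : (j <= n.+1)%N -> (if j is k'.+1 then
    if (k' < n)%N then s + J k' w else t else s) = stopped_time s t j w.
  case: j => // j _ /=; case: ltnP => jn; first by rewrite min_r// ltW// Hn.
  by rewrite min_l// leNgt Hn -leqNgt.
have kn := ltn_ord k.
by have /= -> := timeE k.+1 kn; have -> := timeE k (ltnW kn).
Qed.

Lemma measurable_stopped_time s t k : measurable_fun setT (stopped_time s t k).
Proof.
case: k => [|k] /=; first exact: measurable_cst.
apply: measurable_minr => //; apply: measurable_funD => //.
exact: measurable_jump_time.
Qed.

Lemma measurable_path_action (Q : probability (path_space d R) R) x s t :
  wiener_environment Q -> s < t ->
  measurable_fun setT (fun p : path_space d R * T =>
    path_action J X x s t p.1 p.2).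
Proof.
move=> HQ st.
apply: (@measurable_fun_cvg _ _ _ _ (fun N (p : path_space d R * T) =>
  \sum_(k < N.+1) (env_coord (site x (X ^~ p.2) k) (stopped_time s t k.+1 p.2) p.1
   - env_coord (site x (X ^~ p.2) k) (stopped_time s t k p.2) p.1))).
- move=> N; apply: measurable_sum => k; apply: measurable_funB.
    exact: (measurable_env_comp HQ (measurable_fibers_site x k)
      (measurable_stopped_time s t k.+1)).
  exact: (measurable_env_comp HQ (measurable_fibers_site x k)
    (measurable_stopped_time s t k)).
- move=> p _; apply/cvgrPdist_le => e e0.
  have [N HN] := jump_time_unbounded p.2 (t - s).
  exists N => // k /= Nk.
  rewrite (@path_actionE _ _ _ _ _ k)// ?subrr ?normr0 ?(ltW e0)//; apply: ltW.
  rewrite -ltrBlDl; apply: (lt_le_trans HN).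
  elim: k Nk => [|k IH]; first by rewrite leqn0 => /eqP ->.
  rewrite leq_eqVlt => /predU1P[-> //|Nk].
  exact: le_trans (IH Nk) (ltW (J_incr _ _)).
Qed.

End walk_paths.

(** * The two-replica formula for the correlations *)

Section partition_function.
Context {d : nat} {dT : measure_display} {T : measurableType dT} {R : realType}.
Variables (P : probability T R) (J : nat -> T -> R) (X : nat -> T -> lattice d).
Hypothesis hwalk : simple_random_walk P J X.
Variables (Q : probability (path_space d R) R).
Hypothesis HQ : wiener_environment Q.
Variables (beta : R) (x : lattice d) (s : R).

Definition walk_pair : probability (T * T)%type R := (P \x P)%E.

Definition path_weight (t : R) (om : environment d R) (w : T) : R :=
  expR (beta * path_action J X x s t om w - beta ^+ 2 / 2 * (t - s)).

Lemma measurable_path_weight t : s < t ->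
  measurable_fun setT (fun p : path_space d R * T => path_weight t p.1 p.2).
Proof.
move=> st; apply: measurableT_comp => //; apply: measurable_funB => //.
apply: measurable_funM => //.
exact: (measurable_path_action hwalk x HQ st).
Qed.

Lemma measurable_path_weight_walk t om : s < t ->
  measurable_fun setT (path_weight t om).
Proof.
move=> st.
exact: measurableT_comp (measurable_path_weight st)
  (@measurable_pair1 _ _ (path_space d R) T om).
Qed.

(** The conditional expectation is an integral over the event that the walk ends
    at y, divided by the probability of the event, which cancels the factor
    p_(t - s). If the event is null, both sides vanish. *)
Lemma Zpoint_integral t om y : s < t ->
  Zpoint P J X beta x s y t om =
  (\int[P]_(w in [set: T] `&` ((Defs.eta J X x s t) @^-1` [set y]))
     (path_weight t om w)%:E)%E.
Proof.
move=> st; rewrite setTI.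
have mY : measurable ((Defs.eta J X x s t) @^-1` [set y]).
  exact: (measurable_fibers_eta hwalk).
have mA : measurable_fun setT (fun w => expR (beta * path_action J X x s t om w)).
  apply: measurableT_comp => //; apply: measurable_funM => //.
  exact: measurableT_comp (measurable_path_action hwalk x HQ st)
    (@measurable_pair1 _ _ (path_space d R) T om).
rewrite /Zpoint /bridge_expectation.
have -> : walk_prob P J X (t - s) (y - x) =
    fine (P [set w | Defs.eta J X x s t w = y]).
  rewrite /walk_prob; congr (fine (P _)); apply/seteqP; split => w;
    rewrite /= !etaE subr0 /site add0r.
    by move=> ->; rewrite addrC subrK.
  by move=> <-; rewrite addrAC subrr add0r.
set p := P _; set I := (\int[P]_(w in _) _)%E.
have E : (I * (expR (- (beta ^+ 2 / 2) * (t - s)))%:E =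
    \int[P]_(w in Defs.eta J X x s t @^-1` [set y]) (path_weight t om w)%:E)%E.
  rewrite /I -ge0_integralZr//=; last first.
    by apply/measurable_EFinP; exact: measurable_funTS.
  by apply: eq_integral => w _; rewrite -EFinM -expRD mulNr.
have [p0|p0] := eqVneq (fine p) 0.
  rewrite p0 mulr0 mul0e -E.
  suff -> : I = 0%E by rewrite mul0e.
  apply: null_set_integral => //.
    by apply/measurable_EFinP; exact: measurable_funTS.
  have : p \is a fin_num by apply: fin_num_measure.
  move=> pfin; transitivity (fine p)%:E; last by rewrite p0.
  exact: esym (fineK pfin).
by rewrite -E (muleC I) muleA -EFinM mulfK// muleC.
Qed.

Lemma Zline_integral t om : s < t ->
  Zline P J X beta x s t om = (\int[P]_w (path_weight t om w)%:E)%E.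
Proof.
move=> st; rewrite /Zline.
under eq_esum do rewrite Zpoint_integral//.
rewrite (@esum_integral_fibers _ _ _ _ P (Defs.eta J X x s t) setT)//.
- exact: (measurable_fibers_eta hwalk).
- by apply/measurable_EFinP; exact: measurable_path_weight_walk.
- by move=> w; rewrite lee_fin expR_ge0.
Qed.

Lemma Zline_ge0 t om : s < t -> (0 <= Zline P J X beta x s t om)%E.
Proof.
move=> st; rewrite Zline_integral//; apply: integral_ge0 => w _.
by rewrite lee_fin expR_ge0.
Qed.

Lemma measurable_Zline t : s < t ->
  measurable_fun setT (Zline P J X beta x s t : path_space d R -> \bar R).
Proof.
move=> st.
have -> : (Zline P J X beta x s t : path_space d R -> \bar R) =
    fubini_F P (fun p : path_space d R * T => (path_weight t p.1 p.2)%:E).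
  by apply/funext => om; rewrite Zline_integral.
apply: measurable_fun_fubini_tonelli_F.
- by apply/measurable_EFinP; exact: measurable_path_weight.
- by move=> p; rewrite lee_fin expR_ge0.
Qed.

Definition pair_weight (t u : R) (om : environment d R) (p : T * T) : \bar R :=
  (path_weight t om p.1 * path_weight u om p.2)%:E.

Lemma measurable_pair_weight t u : s < t -> s < u ->
  measurable_fun setT
    (fun p : path_space d R * (T * T) => pair_weight t u p.1 p.2).
Proof.
move=> st su; apply/measurable_EFinP; apply: measurable_funM.
  apply: (measurableT_comp (measurable_path_weight st) (_ : measurable_fun setT
    (fun p : path_space d R * (T * T) => (p.1, p.2.1)))).
  apply: measurable_fun_pair; first exact: measurable_fst.
  exact: measurableT_comp measurable_fst measurable_snd.
apply: (measurableT_comp (measurable_path_weight su) (_ : measurable_fun setT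
  (fun p : path_space d R * (T * T) => (p.1, p.2.2)))).
apply: measurable_fun_pair; first exact: measurable_fst.
exact: measurableT_comp measurable_snd measurable_snd.
Qed.

Lemma pair_weight_ge0 t u om p : (0 <= pair_weight t u om p)%E.
Proof. by rewrite lee_fin mulr_ge0 ?expR_ge0. Qed.

Definition pair_correlation (t u : R) (p : T * T) : \bar R :=
  (\int[Q]_om pair_weight t u om p)%E.

Lemma measurable_pair_correlation t u : s < t -> s < u ->
  measurable_fun setT (pair_correlation t u).
Proof.
move=> st su.
apply: (@measurable_fun_fubini_tonelli_G _ _ _ _ _ Q
  (fun p : path_space d R * (T * T) => pair_weight t u p.1 p.2)).
- exact: measurable_pair_weight.
- by move=> p; exact: pair_weight_ge0.
Qed.

(** Two replicas: the product of two averages over the walk is an average over two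
    independent walks, and Tonelli exchanges it with the average over the
    environment. *)
Lemma Zline_correlation t u : s < t -> s < u ->
  (\int[Q]_om (Zline P J X beta x s t om * Zline P J X beta x s u om) =
   \int[walk_pair]_p pair_correlation t u p)%E.
Proof.
move=> st su.
have w0 v om w : (0 <= (path_weight v om w)%:E)%E by rewrite lee_fin expR_ge0.
have mw v om : s < v -> measurable_fun setT (fun w => (path_weight v om w)%:E).
  by move=> sv; apply/measurable_EFinP; exact: measurable_path_weight_walk.
transitivity (\int[Q]_om \int[walk_pair]_p pair_weight t u om p)%E.
  apply: eq_integral => om _; rewrite !Zline_integral//.
  rewrite [RHS]fubini_tonelli1; last 2 first.
  - exact: measurableT_comp (measurable_pair_weight st su)
      (@measurable_pair1 _ _ (path_space d R) _ om).
  - by move=> p; exact: pair_weight_ge0.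
  rewrite -ge0_integralZr//; last first.
    exact: integral_ge0.
    exact: mw.
  apply: eq_integral => w _; rewrite /fubini_F -ge0_integralZl//.
  by exact: mw.
rewrite (@fubini_tonelli _ _ _ _ _ Q walk_pair
  (fun p : path_space d R * (T * T) => pair_weight t u p.1 p.2))//.
- exact: measurable_pair_weight.
- by move=> p; exact: pair_weight_ge0.
Qed.

End partition_function.

Section overlaps.
Context {R : realType}.

(** Stopping two intervals at t and at u amounts to stopping their intersection
    at min t u. *)
Lemma overlap_stopped (t u a b a' b' : R) :
  overlap (Num.min t a) (Num.min t b) (Num.min u a') (Num.min u b') =
  Num.max 0 (Num.min (Num.min t u) (Num.min b b') - Num.max a a').
Proof.
rewrite /overlap minACA.
set m := Num.min (Num.min t u) _.
have mt : m <= t by rewrite !ge_min lexx.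
have mu : m <= u by rewrite !ge_min lexx orbT.
have [ta|ta] := leP t a.
  rewrite max_l; last by rewrite subr_le0 le_max mt.
  by rewrite max_l// subr_le0 le_max (le_trans mt ta).
have [ua|ua] := leP u a'; last by [].
rewrite max_l; last by rewrite subr_le0 le_max mu orbT.
by rewrite max_l// subr_le0 le_max (le_trans mu ua) orbT.
Qed.

Lemma overlap_sym (a b a' b' : R) : overlap a b a' b' = overlap a' b' a b.
Proof. by congr (Num.max 0 (_ - _)); [exact: minC|exact: maxC]. Qed.

Lemma sum_self_overlap (V : eqType) (z : nat -> V) (tau : nat -> R) (n : nat) :
  (forall k, tau k <= tau k.+1) ->
  \sum_(j < n) \sum_(k < n) (z j == z k)%:R *
    overlap (tau j) (tau j.+1) (tau k) (tau k.+1) = tau n - tau 0%N.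
Proof.
move=> tau_nd.
have tau_homo i j : (i <= j)%N -> tau i <= tau j.
  by move/(homo_leq lexx le_trans tau_nd).
have disj i j : (i < j)%N -> overlap (tau i) (tau i.+1) (tau j) (tau j.+1) = 0.
  move=> ij; rewrite /overlap max_l// subr_le0 ge_min le_max.
  by rewrite (tau_homo _ _ ij) orbT.
rewrite -telescope_sumr// big_mkord; apply: eq_bigr => j _.
rewrite (bigD1 j)//= eqxx mul1r big1 ?addr0 => [|k kj].
  by rewrite /overlap minxx maxxx max_r// subr_ge0.
have [jk|jk] := ltnP j k; first by rewrite disj// mulr0.
rewrite overlap_sym disj ?mulr0// ltn_neqAle jk andbT.
by apply: contra_neq kj => /val_inj.
Qed.

End overlaps.

Section correlation_value.
Context {d : nat} {dT : measure_display} {T : measurableType dT} {R : realType}.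
Variables (P : probability T R) (J : nat -> T -> R) (X : nat -> T -> lattice d).
Hypothesis hwalk : simple_random_walk P J X.
Variables (Q : probability (path_space d R) R).
Hypothesis HQ : wiener_environment Q.
Variables (beta : R) (x : lattice d) (s : R).

Definition arrival_time (k : nat) (w : T) : R :=
  if k is k'.+1 then s + J k' w else s.

(** The time in [s, m[ during which the two walks sit at the same site, provided
    that they make at most N jumps before m. *)
Definition common_time (N : nat) (m : R) (w w' : T) : R :=
  \sum_(j < N.+1) \sum_(k < N.+1)
    (site x (X ^~ w) j == site x (X ^~ w') k)%:R *
    Num.max 0 (Num.min m (Num.min (arrival_time j.+1 w) (arrival_time k.+1 w'))
               - Num.max (arrival_time j w) (arrival_time k w')).

Lemma common_time_nd N m m' w w' : m <= m' ->
  common_time N m w w' <= common_time N m' w w'.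
Proof.
move=> mm'; apply: ler_sum => j _; apply: ler_sum => k _.
apply: ler_wpM2l => //; rewrite ge_max !le_max lexx/=.
apply/orP; right; rewrite lerD2r; move: (Num.min (s + _) _) => Y.
by rewrite le_min !ge_min mm' lexx orbT.
Qed.

Lemma stopped_timeE t k w : s < t ->
  stopped_time J s t k w = Num.min t (arrival_time k w).
Proof. by move=> st; case: k => //=; rewrite min_r// ltW. Qed.

Lemma arrival_time_nd k w : arrival_time k w <= arrival_time k.+1 w.
Proof.
case: k => [|k] /=; last by rewrite lerD2l ltW// (poisson_increasing (walk_jump_times hwalk)).
by rewrite lerDl ltW// (jump_time_gt0 hwalk).
Qed.

(** The exponents of both paths are increments of the environment over boxes. The
    pairs of boxes of the same path contribute t - s and u - s, which the
    normalisations cancel; the two symmetric families of mixed pairs contribute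
    twice the common time. *)
Lemma pair_correlationE t u w w' N : s < t -> s < u ->
  t <= s + J N w -> u <= s + J N w' ->
  pair_correlation J X Q beta x s t u (w, w') =
  (expR (beta ^+ 2 * common_time N (Num.min t u) w w'))%:E.
Proof.
move=> st su tN uN.
pose Idx : finType := ('I_N.+1 + 'I_N.+1)%type.
pose z (k : Idx) := match k with
  inl j => site x (X ^~ w) j | inr j => site x (X ^~ w') j end.
pose a (k : Idx) := match k with
  inl j => stopped_time J s t j w | inr j => stopped_time J s u j w' end.
pose b (k : Idx) := match k with
  inl j => stopped_time J s t j.+1 w | inr j => stopped_time J s u j.+1 w' end.
have nd v v' (k : nat) : s < v ->
    stopped_time J s v k v' <= stopped_time J s v k.+1 v'.
  move=> sv; rewrite !stopped_timeE// le_min !ge_min lexx/=.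
  by rewrite arrival_time_nd orbT.
have ab k : a k <= b k by case: k => k; exact: nd.
have endT v v' : s < v -> v <= s + J N v' -> stopped_time J s v N.+1 v' = v.
  by move=> _ H; rewrite /= min_l.
pose c := expR (- (beta ^+ 2 / 2 * ((t - s) + (u - s)))).
transitivity (\int[Q]_om ((expR (beta * \sum_k (om (z k) (b k) - om (z k) (a k))))%:E
    * c%:E))%E.
  apply: eq_integral => om _; rewrite /pair_weight /path_weight/=.
  rewrite -EFinM -!expRD (path_actionE hwalk x _ st tN) (path_actionE hwalk x _ su uN).
  by rewrite big_sumType/=; congr (EFin (expR _)); ring.
rewrite ge0_integralZr//; last 2 first.
- apply/measurable_EFinP; apply: measurableT_comp => //.
  apply: measurable_funM => //; apply: measurable_sum => k.
  by apply: measurable_funB; exact: (env_coord_measurable HQ).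
- by rewrite lee_fin expR_ge0.
rewrite (environment_boxes_mgf HQ _ _ ab) -EFinM -expRD; congr (EFin (expR _)).
have crossE : \sum_(j < N.+1) \sum_(k < N.+1)
    (site x (X ^~ w) j == site x (X ^~ w') k)%:R *
    overlap (stopped_time J s t j w) (stopped_time J s t j.+1 w)
      (stopped_time J s u k w') (stopped_time J s u k.+1 w') =
    common_time N (Num.min t u) w w'.
  apply: eq_bigr => j _; apply: eq_bigr => k _; congr (_ * _).
  by rewrite !stopped_timeE// overlap_stopped.
pose G (k l : Idx) := (z k == z l)%:R * overlap (a k) (b k) (a l) (b l).
have -> : \sum_k \sum_l G k l =
    \sum_(j < N.+1) \sum_(k < N.+1) G (inl j) (inl k) +
    \sum_(j < N.+1) \sum_(k < N.+1) G (inl j) (inr k) +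
    (\sum_(j < N.+1) \sum_(k < N.+1) G (inr j) (inl k) +
     \sum_(j < N.+1) \sum_(k < N.+1) G (inr j) (inr k)).
  rewrite big_sumType; congr (_ + _); rewrite -big_split;
    by apply: eq_bigr => j _; exact: big_sumType.
have -> : \sum_(j < N.+1) \sum_(k < N.+1) G (inl j) (inl k) = t - s.
  rewrite -[in RHS](endT t w st tN).
  by apply: (@sum_self_overlap _ _ (site x (X ^~ w))
    (fun k => stopped_time J s t k w)) => k; exact: nd.
have -> : \sum_(j < N.+1) \sum_(k < N.+1) G (inr j) (inr k) = u - s.
  rewrite -[in RHS](endT u w' su uN).
  by apply: (@sum_self_overlap _ _ (site x (X ^~ w'))
    (fun k => stopped_time J s u k w')) => k; exact: nd.
have -> : \sum_(j < N.+1) \sum_(k < N.+1) G (inr j) (inl k) =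
    common_time N (Num.min t u) w w'.
  rewrite exchange_big -crossE; apply: eq_bigr => j _; apply: eq_bigr => k _.
  by rewrite /G eq_sym overlap_sym.
by rewrite crossE; field.
Qed.

End correlation_value.

(** * The law of the walk along a time grid *)

Section steps.
Context {d : nat} {dT : measure_display} {T : measurableType dT} {R : realType}.
Variables (P : probability T R) (J : nat -> T -> R) (X : nat -> T -> lattice d).
Hypothesis hwalk : simple_random_walk P J X.
Hypothesis d_gt0 : (0 < d)%N.
Local Notation q := (@srw_transition R d).

Lemma unit_step_inj : injective (fun p : 'I_d * bool => unit_step p.1 p.2).
Proof.
move=> [i b] [j c] /= /matrixP H.
have ij : i = j.
  apply/eqP; apply: contraT => ij; have := H 0 i.
  rewrite /unit_step !mxE !eqxx/= (negbTE ij) mulr0 mulr1.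
  by case: b {H} => /eqP; rewrite ?expr0 ?expr1.
congr (_, _) => //; have := H 0 i.
rewrite /unit_step ij !mxE !eqxx/= !mulr1.
by case: b {H}; case: c.
Qed.

Lemma srw_transition_ge0 n z : 0 <= q n z.
Proof.
elim: n z => [|n IH] z /=; first by rewrite ler0n.
rewrite mulr_ge0 ?invr_ge0//; apply: sumr_ge0 => i _; apply: sumr_ge0 => b _.
exact: IH.
Qed.

Lemma measurable_step k a : measurable (X k @^-1` [set a]).
Proof. exact: (walk_step_measurable hwalk). Qed.

(** The 2 d unit steps have total probability 1, so almost surely every step is
    a unit step. *)
Lemma step_partition k (B : set T) : measurable B ->
  P B = (\sum_(p : 'I_d * bool) P (B `&` X k @^-1` [set unit_step p.1 p.2]))%E.
Proof.
move=> mB.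
pose F (p : 'I_d * bool) := X k @^-1` [set unit_step p.1 p.2].
have mF p : measurable (F p) by exact: measurable_step.
have tF : trivIset setT F.
  by move=> p p' _ _ [w []]; rewrite /F/= => -> /unit_step_inj.
pose U := \bigcup_(p in [set: 'I_d * bool]) F p.
have mU : measurable U by apply: fin_bigcup_measurable.
have sumE (A : set T) : measurable A -> P (A `&` U) =
    (\sum_(p : 'I_d * bool) P (A `&` F p))%E.
  move=> mA; rewrite /U setI_bigcupr measure_fin_bigcup//.
  - rewrite [RHS]fsbig_seq ?index_enum_uniq//; apply: eq_fsbigl.
    by apply/seteqP; split => p _ //=; rewrite mem_index_enum.
  - exact: finite_finset.
  - by apply: trivIset_setIl.
  - by move=> p _; apply: measurableI.
have PU : P U = 1%E.
  have := sumE setT measurableT; rewrite setTI => ->.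
  rewrite (eq_bigr (fun=> ((2 * d)%:R^-1)%:E)); last first.
    move=> p _; rewrite setTI; exact: (walk_step_uniform hwalk).
  rewrite sumEFin sumr_const card_prod card_ord card_bool; congr EFin.
  rewrite -[LHS]mulr_natr (mulnC d 2) mulVf//.
  by rewrite pnatr_eq0 muln_eq0/= -lt0n.
rewrite -sumE//.
have PUc : P (~` U) = 0%E by rewrite probability_setC// PU subee.
rewrite -[in LHS](setIT B) -(setUv U) setIUr measureU//.
- rewrite [X in (_ + X)%E](_ : _ = 0%E) ?adde0//.
  apply/eqP; rewrite eq_le measure_ge0 andbT -PUc.
  by apply: le_measure; rewrite ?inE//; [apply: measurableI => //; exact: measurableC
    |exact: measurableC].
- exact: measurableI.
- by apply: measurableI => //; exact: measurableC.
- by rewrite setIACA setICr setI0.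
Qed.

Definition step_cylinder (j k : nat) (a : nat -> lattice d) : set T :=
  \bigcap_(i in `I_k) X (j + i)%N @^-1` [set a i].

Lemma measurable_step_cylinder j k a : measurable (step_cylinder j k a).
Proof. by apply: fin_bigcap_measurable => // i _; exact: measurable_step. Qed.

Lemma step_cylinderS j k a : step_cylinder j k.+1 a =
  X j @^-1` [set a 0%N] `&` step_cylinder j.+1 k (a \o succn).
Proof.
apply/seteqP; split => w /=.
  move=> H; split; first by have := H 0%N isT; rewrite addn0.
  by move=> i /= ik; have := H i.+1 ik; rewrite addnS.
move=> [H0 H] [|i] /= ik; first by rewrite addn0.
by rewrite addnS; exact: H.
Qed.

(** Independence of A from the steps X j, X (j + 1), ..., tested on cylinders only. *)
Definition before_step (j : nat) (A : set T) : Prop :=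
  measurable A /\ forall k a,
    (P (A `&` step_cylinder j k a) =
     P A * \prod_(i < k) P (X (j + i)%N @^-1` [set a i]))%E.

Lemma before_stepS j A e : before_step j A ->
  before_step j.+1 (A `&` X j @^-1` [set e]) /\
  P (A `&` X j @^-1` [set e]) = (P A * P (X j @^-1` [set e]))%E.
Proof.
move=> [mA H].
have PAe : P (A `&` X j @^-1` [set e]) = (P A * P (X j @^-1` [set e]))%E.
  have := H 1%N (fun=> e); rewrite step_cylinderS /step_cylinder.
  have -> : `I_0 = set0 :> set nat by apply/seteqP; split.
  by rewrite bigcap_set0 setIT big_ord1 addn0.
split => //; split; first exact: measurableI (measurable_step j e).
move=> k a; rewrite PAe -setIA.
pose a' i := if i is i'.+1 then a i' else e.
have := H k.+1 a'; rewrite step_cylinderS big_ord_recl/= addn0 muleA => ->.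
by congr (_ * _)%E; apply: eq_bigr => i _; rewrite /bump/= add1n addSnnS.
Qed.

Lemma before_step_of_jumps A : measurable A -> sigma_of_process J A ->
  before_step 0 A.
Proof.
move=> mA JA; split => // k a.
pose r := None :: map Some (iota 0 k).
pose E o := if o is Some i then X i @^-1` [set a i] else A.
have := @mutual_independence_bigcap _ _ _ _ _ r E (walk_independent hwalk).
rewrite {2}/r big_cons big_map (_ : iota 0 k = index_iota 0 k) ?big_mkord; last by rewrite /index_iota subn0.
have -> : \bigcap_(o in [set` r]) E o = A `&` step_cylinder 0 k a.
  apply/seteqP; split => w.
    move=> H; split; first exact: (H None).
    move=> i /= ik; apply: (H (Some i)).
    by rewrite /= /r inE/= map_f// mem_iota.
  move=> [Aw H] [i|] //= ; rewrite /r inE/= => /mapP[i' + [->]].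
  by rewrite mem_iota => /= ik; have := H i' ik.
apply.
  by rewrite /r /= map_inj_uniq ?iota_uniq ?andbT => [|? ? []//];
    apply/mapP => -[].
move=> [i|] //= _; exists [set a i] => //.
by rewrite setTI.
Qed.

Definition displacement (j n : nat) (w : T) : lattice d :=
  \sum_(i < n) X (j + i)%N w.

Lemma measurable_displacement j n z :
  measurable (displacement j n @^-1` [set z]).
Proof.
rewrite /displacement; elim: n z => [|n IH] z.
  under eq_fun do rewrite big_ord0.
  by rewrite preimage_cst; case: ifP.
under eq_fun do rewrite big_ord_recr/=.
apply: (@measurable_fibers_pair _ _ _ _ _ _ _ _ IH) => a.
exact: measurable_step.
Qed.

(** Conditioning on the next step is the recursion that defines srw_transition. *)
Lemma before_step_displacement j n A z : before_step j A ->
  before_step (j + n) (A `&` displacement j n @^-1` [set z]) /\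
  P (A `&` displacement j n @^-1` [set z]) = (P A * (q n z)%:E)%E.
Proof.
elim: n j A z => [|n IH] j A z HA.
  have -> : displacement j 0 = cst 0.
    by apply/funext => w; rewrite /displacement big_ord0.
  rewrite addn0 preimage_cst /=.
  have [->|z0] := eqVneq z 0.
    by rewrite mem_set// setIT mule1.
  rewrite memNset; last by move=> /= /esym/eqP; rewrite (negbTE z0).
  rewrite setI0 measure0 mule0; split => //; split => // k a.
  by rewrite set0I measure0 mul0e.
pose Ap (p : 'I_d * bool) := A `&` X j @^-1` [set unit_step p.1 p.2].
have HAp p : before_step j.+1 (Ap p) /\ P (Ap p) = (P A * ((2 * d)%:R^-1)%:E)%E.
  have [H1 H2] := before_stepS (unit_step p.1 p.2) HA.
  by split=> //; rewrite H2 (walk_step_uniform hwalk).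
have mD j' n' z' : measurable (displacement j' n' @^-1` [set z']).
  exact: measurable_displacement.
have dispS w : displacement j n.+1 w = X j w + displacement j.+1 n w.
  rewrite /displacement big_ord_recl addn0; congr (_ + _).
  by apply: eq_bigr => i _; rewrite lift0 addSnnS.
have split_ (C : set T) : measurable C ->
    (P (A `&` displacement j n.+1 @^-1` [set z] `&` C) =
    \sum_(p : 'I_d * bool)
      P (Ap p `&` displacement j.+1 n @^-1` [set (z - unit_step p.1 p.2)%R] `&` C))%E.
  move=> mC; rewrite (step_partition j); last first.
    by apply: measurableI => //; apply: measurableI => //; case: HA.
  apply: eq_bigr => p _; congr (P _); apply/seteqP; split => w.
    move=> [[[Aw /=]]]; rewrite dispS => <- Cw Xw; split => //; split => //.
    by rewrite /= -Xw addrAC subrr add0r.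
  move=> [[[Aw /= Xw]]] Dw Cw; split => //; split => //; split => //.
  by rewrite /= dispS Dw Xw addrC subrK.
have sumq : (\sum_(p : 'I_d * bool)
    P (Ap p `&` displacement j.+1 n @^-1` [set (z - unit_step p.1 p.2)%R]) =
    P A * (q n.+1 z)%:E)%E.
  have PAf : P A \is a fin_num by apply: fin_num_measure; case: HA.
  rewrite -(fineK PAf) -EFinM /= mulrA pair_big/= mulr_sumr -sumEFin.
  apply: eq_bigr => p _; have [HAp1 HAp2] := HAp p.
  by have [_ ->] := IH j.+1 _ (z - unit_step p.1 p.2) HAp1;
    rewrite HAp2 -(fineK PAf) -!EFinM.
have PD : P (A `&` displacement j n.+1 @^-1` [set z]) = (P A * (q n.+1 z)%:E)%E.
  rewrite -[X in P X]setIT split_// -sumq.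
  by apply: eq_bigr => p _; rewrite setIT.
split=> //; split; first by apply: measurableI => //; case: HA.
move=> k a; rewrite split_; last exact: measurable_step_cylinder.
rewrite PD -sumq ge0_sume_distrl//; apply: eq_bigr => p _.
have [HAp1 _] := HAp p.
have [[_ H] _] := IH j.+1 _ (z - unit_step p.1 p.2) HAp1.
by rewrite -addSnnS H.
Qed.

End steps.

Lemma ge0_nneseriesZl {R : realType} (c : \bar R) (f : nat -> \bar R) :
  (0 <= c)%E -> (forall k, 0 <= f k)%E ->
  (\sum_(k <oo) (c * f k) = c * \sum_(k <oo) f k)%E.
Proof.
move=> c0 f0; rewrite -!ge0_integral_count// ?ge0_integralZl// => k.
exact: mule_ge0.
Qed.

Section skeleton.
Context {d : nat} {dT : measure_display} {T : measurableType dT} {R : realType}.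
Variables (P : probability T R) (J : nat -> T -> R) (X : nat -> T -> lattice d).
Hypothesis hwalk : simple_random_walk P J X.
Hypothesis d_gt0 : (0 < d)%N.
Variable r : nat -> R.
Hypothesis r0 : r 0%N = 0.
Hypothesis r_incr : forall i, r i < r i.+1.
Local Notation q := (@srw_transition R d).

(** The transition probability p_h: a Poisson number of steps. *)
Definition heat_kernel (h : R) (z : lattice d) : \bar R :=
  (\sum_(n <oo) (poisson_pmf h n * q n z)%:E)%E.

Definition jump_number (i : nat) (w : T) : nat :=
  (njumps J (r i.+1) w - njumps J (r i) w)%N.

Definition increment (i : nat) (w : T) : lattice d :=
  displacement X (njumps J (r i) w) (jump_number i w) w.

Let r_nd i : r i <= r i.+1. Proof. exact: ltW. Qed.

Let r_homo i j : (i <= j)%N -> r i <= r j.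
Proof. by move/(homo_leq lexx le_trans r_nd). Qed.

Lemma njumps_nd (a b : R) w : a <= b -> (njumps J a w <= njumps J b w)%N.
Proof.
move=> ab; rewrite leqNgt; apply/negP => H.
have := njumpsP hwalk a w (njumps J b w); rewrite H => Ha.
by have := njumpsP hwalk b w (njumps J b w); rewrite ltnn (le_trans Ha ab).
Qed.

Lemma njumps0 w : njumps J (r 0%N) w = 0%N.
Proof.
apply/eqP; rewrite -leqn0 leqNgt -(njumpsP hwalk) -ltNge r0.
exact: jump_time_gt0 hwalk _ _.
Qed.

Lemma jump_numberE i w :
  npoints `]r i, r i.+1] (J ^~ w) = (jump_number i w)%:R%:E :> \bar R.
Proof.
rewrite /npoints.
have -> : [set k | `]r i, r i.+1]%classic (J k w)] =
    [set` [fset k in index_iota (njumps J (r i) w) (njumps J (r i.+1) w)]%fset].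
  apply/seteqP; split => k /=; rewrite in_fset mem_index_iota in_itv/=
    -(njumpsP hwalk) leqNgt -(njumpsP hwalk) -ltNge => //.
rewrite /counting asboolT ?set_fsetK//.
by rewrite card_fseq undup_id ?iota_uniq// size_iota.
Qed.

Lemma jump_numbers_law (m : nat) (n : nat -> nat) :
  P (\bigcap_(i in `I_m) jump_number i @^-1` [set n i]) =
  (\prod_(i < m) (poisson_pmf (r i.+1 - r i) (n i))%:E)%E.
Proof.
have PJ := walk_jump_times hwalk.
pose B (i : 'I_m) : set R := `]r i, r i.+1]%classic.
have mB i : measurable (B i) /\ B i `<=` `]0, +oo[%classic.
  split; first exact: measurable_itv.
  move=> y; rewrite /B/= !in_itv/= andbT => /andP[ry _].
  by apply: le_lt_trans ry; rewrite -r0; exact: r_homo.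
have tB : trivIset setT B.
  move=> i j _ _ [y []]; rewrite /B/= !in_itv/= => /andP[iy yi] /andP[jy yj].
  apply/val_inj/eqP; rewrite eqn_leq; apply/andP; split; rewrite leqNgt; apply/negP.
    by move=> /r_homo /(le_trans yj) /le_lt_trans/(_ iy); rewrite ltxx.
  by move=> /r_homo /(le_trans yi) /le_lt_trans/(_ jy); rewrite ltxx.
have indep := poisson_independent PJ mB tB.
pose E (i : 'I_m) := [set w | npoints (B i) (J ^~ w) = (n i)%:R%:E].
have := @mutual_independence_bigcap _ _ _ _ _ (index_enum 'I_m) E indep.
have -> : \bigcap_(i in [set` index_enum 'I_m]) E i =
    \bigcap_(i in `I_m) jump_number i @^-1` [set n i].
  apply/seteqP; split => w H i /=.
    move=> im; have := H (Ordinal im); rewrite /= mem_index_enum => /(_ isT).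
    by rewrite /E/= jump_numberE => -[] /eqP; rewrite eqr_nat => /eqP.
  by move=> _; rewrite /E/= jump_numberE (H i (ltn_ord i)).
move=> ->.
- apply: eq_bigr => i _; rewrite (poisson_count PJ); first last.
  + by rewrite /B lebesgue_measure_itv/= lte_fin r_incr -EFinB ltry.
  + by have [] := mB i.
  + by have [] := mB i.
  have -> : fine (lebesgue_measure (B i)) = r i.+1 - r i.
    by rewrite /B lebesgue_measure_itv/= lte_fin r_incr.
  rewrite /poisson_prob subr_gt0 r_incr esum_set1// lee_fin.
  exact: poisson_pmf_ge0.
- exact: index_enum_uniq.
- move=> i _; exists [set (n i)%:R%:E]; first exact: emeasurable_set1.
  by rewrite setTI.
Qed.

Lemma measurable_jump_numbers (m : nat) (n : nat -> nat) :
  measurable (\bigcap_(i in `I_m) jump_number i @^-1` [set n i]).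
Proof.
apply: fin_bigcap_measurable => // i _.
apply: (@measurable_fibers_pair _ _ _ _ _ _ _ (fun a b => (a - b)%N));
  exact: (measurable_fibers_njumps hwalk).
Qed.

Lemma jump_numbers_sigma (m : nat) (n : nat -> nat) :
  sigma_of_process J (\bigcap_(i in `I_m) jump_number i @^-1` [set n i]).
Proof.
pose G := \bigcup_j g_sigma_algebra_preimage (J j).
have mJ j : measurable_fun (setT : set (g_sigma_algebraType G)) (J j).
  move=> _ B mB; apply: sub_sigma_algebra; exists j => //.
  by exists B => //; rewrite setTI.
have mN t : @measurable_fibers _ (g_sigma_algebraType G) _ (njumps J t).
  apply: (@measurable_fibers_count _ (g_sigma_algebraType G) _
      (fun k (w : g_sigma_algebraType G) => J k w <= t)) => [k|w k].
    rewrite -[X in measurable X]setTI.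
    exact: (measurable_fun_ler (mJ k) (measurable_cst t)) measurableT [set true] I.
  exact: (njumpsP hwalk).
suff : measurable ((\bigcap_(i in `I_m) jump_number i @^-1` [set n i]) :
  set (g_sigma_algebraType G)) by [].
apply: fin_bigcap_measurable => // i _.
exact: (@measurable_fibers_pair _ _ _ _ _ _ _ (fun a b => (a - b)%N)
  (mN (r i.+1)) (mN (r i)) (n i)).
Qed.

(** Given the numbers of jumps in each interval, the increments are displacements
    over consecutive blocks of steps, and these are independent. *)
Lemma skeleton_jump_law (m : nat) (n : nat -> nat) (z : nat -> lattice d) :
  P (\bigcap_(i in `I_m) increment i @^-1` [set z i] `&`
     \bigcap_(i in `I_m) jump_number i @^-1` [set n i]) =
  (\prod_(i < m) (poisson_pmf (r i.+1 - r i) (n i) * q (n i) (z i))%:E)%E.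
Proof.
pose C := \bigcap_(i in `I_m) jump_number i @^-1` [set n i].
pose cum i := (\sum_(l < i) n l)%N.
have cumE w i : C w -> (i <= m)%N -> njumps J (r i) w = cum i.
  move=> Cw; elim: i => [|i IH] im; first by rewrite njumps0 /cum big_ord0.
  rewrite /cum big_ord_recr/= -/(cum i) -(IH (ltnW im)) -(Cw i im).
  by rewrite subnKC// njumps_nd.
pose A j := C `&` \bigcap_(i in `I_j) displacement X (cum i) (n i) @^-1` [set z i].
have HA j : before_step P X (cum j) (A j) /\
    P (A j) = (P C * \prod_(i < j) (q (n i) (z i))%:E)%E.
  elim: j => [|j [IH1 IH2]].
    rewrite /cum !big_ord0 mule1 /A.
    have -> : `I_0 = set0 :> set nat by apply/seteqP; split.
    rewrite bigcap_set0 setIT; split => //.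
    apply: (before_step_of_jumps hwalk) => //.
      exact: measurable_jump_numbers.
    exact: jump_numbers_sigma.
  have -> : A j.+1 = A j `&` displacement X (cum j) (n j) @^-1` [set z j].
    apply/seteqP; split => w.
      move=> [Cw H]; split; last exact: H (ltnSn j).
      by split => // i /= ij; apply: H; exact: ltnW.
    move=> [[Cw H] Dj]; split => // i /=; rewrite ltnS leq_eqVlt.
    by move=> /predU1P[-> //|]; exact: H.
  have [H1 H2] := before_step_displacement hwalk d_gt0 (n j) (z j) IH1.
  rewrite {1}/cum big_ord_recr -/(cum j); split => //.
  by rewrite H2 IH2 big_ord_recr/= muleA.
have -> : \bigcap_(i in `I_m) increment i @^-1` [set z i] `&` C = A m.
  apply/seteqP; split => w [].
    move=> H Cw; split => // i /= im; have := H i im.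
    by rewrite /= /increment (Cw i im) (cumE _ _ Cw (ltnW im)).
  move=> Cw H; split => // i /= im; have := H i im.
  by rewrite /= /increment (Cw i im) (cumE _ _ Cw (ltnW im)).
have [_ ->] := HA m.
rewrite jump_numbers_law -big_split/=; apply: eq_bigr => i _.
by rewrite EFinM.
Qed.

Lemma heat_kernel_ge0 h z : (0 <= heat_kernel h z)%E.
Proof.
apply: nneseries_ge0 => k _ _; rewrite lee_fin mulr_ge0 ?poisson_pmf_ge0//.
exact: srw_transition_ge0.
Qed.

Lemma measurable_fibers_increment i : measurable_fibers (increment i).
Proof.
have mN t : measurable_fibers (njumps J t) by exact: measurable_fibers_njumps hwalk _.
apply: (@measurable_fibers_index _ _ _ _
  (fun w => (njumps J (r i) w, jump_number i w))
  (fun p => displacement X p.1 p.2)) => [|p].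
  apply: (measurable_fibers_pair _ (mN (r i))).
  exact: (@measurable_fibers_pair _ _ _ _ _ _ _ (fun a b => (a - b)%N)
    (mN (r i.+1)) (mN (r i))).
exact: measurable_displacement hwalk _ _.
Qed.

(** Sum the joint law of increments and jump numbers over the jump numbers, one
    interval after the other. *)
Lemma skeleton_law (m : nat) (z : nat -> lattice d) :
  P (\bigcap_(i in `I_m) increment i @^-1` [set z i]) =
  (\prod_(i < m) heat_kernel (r i.+1 - r i) (z i))%E.
Proof.
(* the jump numbers of the first j intervals are prescribed *)
suff H j (n : nat -> nat) : (j <= m)%N ->
    P (\bigcap_(i in `I_m) increment i @^-1` [set z i] `&`
       \bigcap_(i in `I_j) jump_number i @^-1` [set n i]) =
    ((\prod_(0 <= i < j) (poisson_pmf (r i.+1 - r i) (n i) * q (n i) (z i))%:E) *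
     \prod_(j <= i < m) heat_kernel (r i.+1 - r i) (z i))%E.
  have := H 0%N (fun=> 0%N) (leq0n m).
  have -> : `I_0 = set0 :> set nat by apply/seteqP; split.
  by rewrite bigcap_set0 setIT big_geq// mul1e big_mkord.
move jm : (m - j)%N => k; elim: k j n jm => [|k IH] j n jm jlem.
  have -> : j = m by lia.
  by rewrite skeleton_jump_law [X in (_ * X)%E]big_geq// mule1 big_mkord.
have jm' : (j < m)%N by lia.
rewrite -(@esum_measure_fibers _ _ _ _ _ (jump_number j)); last 2 first.
- apply: (@measurable_fibers_pair _ _ _ _ _ _ _ (fun a b => (a - b)%N));
  exact: (measurable_fibers_njumps hwalk).
- apply: measurableI; last exact: measurable_jump_numbers.
  by apply: fin_bigcap_measurable => // i _; exact: measurable_fibers_increment.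
pose n' l i := if i == j then l else n i.
have n'E l i : (i < j)%N -> n' l i = n i.
  by move=> ij; rewrite /n' ltn_eqF.
transitivity (\esum_(l in [set: nat])
   ((\prod_(0 <= i < j) (poisson_pmf (r i.+1 - r i) (n i) * q (n i) (z i))%:E) *
   (\prod_(j.+1 <= i < m) heat_kernel (r i.+1 - r i) (z i)) *
   (poisson_pmf (r j.+1 - r j) l * q l (z j))%:E))%E.
  apply: eq_esum => l _.
  have := IH j.+1 (n' l) _ jm'; rewrite big_nat_recr//= /n' eqxx -/(n' l).
  have -> : (\prod_(0 <= i < j) (poisson_pmf (r i.+1 - r i) (n' l i) *
        q (n' l i) (z i))%:E = \prod_(0 <= i < j) (poisson_pmf (r i.+1 - r i) (n i)
        * q (n i) (z i))%:E)%E.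
    by apply: eq_big_nat => i /andP[_ ij]; rewrite n'E.
  rewrite muleAC => <-; last by lia.
  rewrite -setIA; congr (P (_ `&` _)); apply/seteqP; split => w.
    move=> [H Hj] i /=; rewrite ltnS leq_eqVlt => /predU1P[->|ij].
      by rewrite /n' eqxx.
    by rewrite ltn_eqF//; exact: H.
  move=> H; split; last by have := H j (ltnSn j); rewrite /= /n' eqxx.
  by move=> i /= ij; have := H i (ltnW ij); rewrite /= ltn_eqF.
have c0 i : (0 <= (poisson_pmf (r i.+1 - r i) (n i) * q (n i) (z i))%:E)%E.
  by rewrite lee_fin mulr_ge0 ?poisson_pmf_ge0//; exact: srw_transition_ge0.
have f0 l : (0 <= (poisson_pmf (r j.+1 - r j) l * q l (z j))%:E)%E.
  by rewrite lee_fin mulr_ge0 ?poisson_pmf_ge0//; exact: srw_transition_ge0.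
have C0 : (0 <= (\prod_(0 <= i < j) (poisson_pmf (r i.+1 - r i) (n i) *
    q (n i) (z i))%:E) *
    (\prod_(j.+1 <= i < m) heat_kernel (r i.+1 - r i) (z i)))%E.
  by apply: mule_ge0; apply: prode_ge0 => // i _; exact: heat_kernel_ge0.
rewrite -nneseries_esumT => [|l]; last exact: mule_ge0.
rewrite ge0_nneseriesZl// -/(heat_kernel _ _) -muleA (big_ltn jm').
by rewrite [X in (_ * X)%E = _]muleC.
Qed.

End skeleton.

(** * A discrete Khasminskii lemma *)

Section countable_sums.
Context {R : realType} {U : countType}.
Implicit Types (f : U -> \bar R).

(** Sums over a countable type are series, so that lemmas on series apply. *)
Lemma esum_nneseries f : (forall u, 0 <= f u)%E ->
  (\esum_(u in [set: U]) f u =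
   \sum_(n <oo) oapp f 0 (@choice.pickle_inv U n))%E.
Proof.
move=> f0; rewrite nneseries_esumT => [|n]; last by case: (choice.pickle_inv n) => /=.
transitivity (\esum_(n in range (@choice.pickle U)) oapp f 0%E (choice.pickle_inv n))%E.
  rewrite esum_image => [|a b _ _ /(congr1 (@choice.pickle_inv U))].
    by apply: eq_esum => u _; rewrite choice.pickleK_inv.
  by rewrite !choice.pickleK_inv => -[].
rewrite esum_mkcond; apply: eq_esum => n _; case: ifPn => //.
rewrite notin_setE => nr; case E : (choice.pickle_inv n) => [u|] //=.
exfalso; apply: nr; exists u => //; by have := @choice.pickle_invK U n; rewrite E.
Qed.

Lemma ge0_esumZl (c : \bar R) f : (0 <= c)%E -> (forall u, 0 <= f u)%E ->
  (\esum_(u in [set: U]) (c * f u) = c * \esum_(u in [set: U]) f u)%E.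
Proof.
move=> c0 f0; rewrite !esum_nneseries => [|u|u]; [|exact: f0|exact: mule_ge0].
rewrite -ge0_nneseriesZl => [|//|n]; last by case: (choice.pickle_inv n) => /=.
by apply: eq_eseriesr => n _; case: (choice.pickle_inv n) => //=; rewrite mule0.
Qed.

End countable_sums.

Section khasminskii.
Context {dS : measure_display} {S : measurableType dS} {R : realType}.
Variables (PP : probability S R) (U : countType) (A : zmodType).
Variables (zeta : nat -> S -> U) (g : U -> A) (rho : U -> \bar R)
  (D : nat -> S -> A) (c : R).
Hypothesis mzeta : forall i, measurable_fibers (zeta i).
Hypothesis DS : forall i w, D i.+1 w = D i w + g (zeta i w).
Hypothesis rho_ge0 : forall u, (0 <= rho u)%E.
Let hit i := [set w | D i w = 0].
Hypothesis mD : forall i, measurable (hit i).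
Hypothesis c_ge0 : 0 <= c.

Definition reward (a : A) : R := 1 + c * (a == 0)%:R.

Definition rewards (j k : nat) (w : S) : R :=
  \prod_(i < k) reward (D (j + i).+1 w).

(** The mean of the next k rewards of the chain started at a, whose steps are
    g u with u drawn from the weights rho. *)
Fixpoint mean_rewards (k : nat) (a : A) : \bar R :=
  if k is k'.+1 then
    (\esum_(u in [set: U])
      (rho u * ((reward (a + g u))%:E * mean_rewards k' (a + g u))))%E
  else 1%E.

(** For B the event of a return to 0 at time j, this is the renewal property of the
    chain. *)
Definition future_independent (j : nat) (B : set S) : Prop :=
  measurable B /\ forall k (u : nat -> U),
    (PP (B `&` \bigcap_(i in `I_k) zeta (j + i)%N @^-1` [set u i]) =
     PP B * \prod_(i < k) rho (u i))%E.

Lemma reward_ge0 a : 0 <= reward a.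
Proof. by rewrite addr_ge0 ?mulr_ge0. Qed.

Lemma rewards_ge0 j k w : 0 <= rewards j k w.
Proof. by apply: prodr_ge0 => i _; exact: reward_ge0. Qed.

Lemma mean_rewards_ge0 k a : (0 <= mean_rewards k a)%E.
Proof.
elim: k a => [|k IH] a //=; apply: esum_ge0 => u _.
by rewrite !mule_ge0 ?lee_fin ?reward_ge0.
Qed.

Lemma measurable_hit i : measurable_fun setT (fun w => (D i w == 0)%:R : R).
Proof.
rewrite (_ : (fun w => _) = (\1_(hit i) : S -> R)); first exact: measurable_indic.
apply/funext => w; rewrite indicE; congr (_%:R); congr nat_of_bool.
by apply/eqP/idP; rewrite inE.
Qed.

Lemma measurable_rewards j k : measurable_fun setT (rewards j k).
Proof.
apply: measurable_prod => i _; apply: measurable_funD => //.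
apply: measurable_funM => //.
exact: measurable_hit.
Qed.

Lemma rewardsS j k w :
  rewards j k.+1 w = reward (D j.+1 w) * rewards j.+1 k w.
Proof.
rewrite /rewards big_ord_recl addn0; congr (_ * _); apply: eq_bigr => i _.
by rewrite lift0 addSnnS.
Qed.

Lemma future_independentS j B u : future_independent j B ->
  future_independent j.+1 (B `&` zeta j @^-1` [set u]) /\
  PP (B `&` zeta j @^-1` [set u]) = (PP B * rho u)%E.
Proof.
move=> [mB H].
have capS k (v : nat -> U) : \bigcap_(i in `I_k.+1) zeta (j + i)%N @^-1` [set v i] =
    zeta j @^-1` [set v 0%N] `&`
    \bigcap_(i in `I_k) zeta (j.+1 + i)%N @^-1` [set v i.+1].
  apply/seteqP; split => w.
    move=> K; split; first by have := K 0%N isT; rewrite addn0.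
    by move=> i /= ik; have := K i.+1 ik; rewrite addnS.
  move=> [K0 K] [|i] /= ik; first by rewrite addn0.
  by rewrite addnS; exact: K.
have PPBu : PP (B `&` zeta j @^-1` [set u]) = (PP B * rho u)%E.
  have := H 1%N (fun=> u); rewrite capS.
  have -> : `I_0 = set0 :> set nat by apply/seteqP; split.
  by rewrite bigcap_set0 setIT big_ord1.
split => //; split; first exact: measurableI (mzeta j u).
move=> k v; rewrite PPBu -setIA.
pose v' i := if i is i'.+1 then v i' else u.
by have := H k.+1 v'; rewrite capS big_ord_recl/= muleA.
Qed.

(** The Markov property, by decomposing along the values of the next variable. *)
Lemma integral_rewards j k B a : future_independent j B ->
  (forall w, B w -> D j w = a) ->
  (\int[PP]_(w in B) (rewards j k w)%:E = PP B * mean_rewards k a)%E.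
Proof.
elim: k j B a => [|k IH] j B a HB Ba.
  under eq_integral do rewrite /rewards big_ord0.
  by rewrite integral_cst ?mul1e ?mule1//; case: HB.
have mB : measurable B by case: HB.
have mr j' k' : measurable_fun setT (fun w => (rewards j' k' w)%:E).
  by apply/measurable_EFinP; exact: measurable_rewards.
rewrite -(@esum_integral_fibers _ _ _ _ _ (zeta j))//; last first.
  by move=> w; rewrite lee_fin rewards_ge0.
transitivity (\esum_(u in [set: U]) (PP B *
    (rho u * ((reward (a + g u))%:E * mean_rewards k (a + g u)))))%E.
  apply: eq_esum => u _.
  have [HBu PPBu] := future_independentS u HB.
  transitivity (\int[PP]_(w in B `&` zeta j @^-1` [set u])
      ((reward (a + g u))%:E * (rewards j.+1 k w)%:E))%E.
    apply: eq_integral => w; rewrite inE => -[Bw /= zw].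
    by rewrite rewardsS DS (Ba w Bw) zw EFinM.
  rewrite ge0_integralZl//; last 4 first.
  - by case: HBu.
  - exact: measurable_funTS.
  - by move=> w _; rewrite lee_fin rewards_ge0.
  - by rewrite lee_fin reward_ge0.
  rewrite (IH _ _ (a + g u) HBu); last first.
    by move=> w [Bw /= zw]; rewrite DS (Ba w Bw) zw.
  by rewrite PPBu !muleA; congr (_ * _)%E; rewrite -muleA muleC.
by rewrite ge0_esumZl// => u; rewrite !mule_ge0 ?lee_fin ?reward_ge0 ?mean_rewards_ge0.
Qed.

(** Factors are removed from the left, splitting 1 + c x into its two terms, so
    the sum runs over the first factor from which c x is chosen. *)
Lemma rewards_expansion m w : rewards 0 m w =
  1 + \sum_(i < m) c * (D i.+1 w == 0)%:R * rewards i.+1 (m - i.+1) w.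
Proof.
suff H j k : rewards j k w =
    1 + \sum_(i < k) c * (D (j + i).+1 w == 0)%:R * rewards (j + i).+1 (k - i.+1) w.
  by rewrite H; under eq_bigr do rewrite add0n.
elim: k j => [|k IH] j; first by rewrite big_ord0 addr0 /rewards big_ord0.
rewrite rewardsS {1}/reward mulrDl mul1r {1}IH big_ord_recl addn0 subn1/=.
rewrite -addrA; congr (1 + _); rewrite addrC; congr (_ + _).
by apply: eq_bigr => i _; rewrite /bump add1n addnS subSS addSn.
Qed.

(** The expansion and the renewal property give the recursion
    H_k = 1 + c sum_i P (hit i) H_(k - i) for H_k = mean_rewards k 0; if
    H_j <= 1 / (1 - theta) for j < k, then
    H_k <= 1 + theta / (1 - theta) = 1 / (1 - theta). *)
Theorem khasminskii (theta : R) (m : nat) :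
  (forall w, D 0%N w = 0) -> future_independent 0 setT ->
  (forall i, future_independent i.+1 (hit i.+1)) ->
  theta < 1 ->
  (c%:E * \sum_(i < m) PP (hit i.+1) <= theta%:E)%E ->
  (\int[PP]_w (rewards 0 m w)%:E <= ((1 - theta)^-1)%:E)%E.
Proof.
move=> D0 indep0 indep theta1 Hc.
have -> : (\int[PP]_w (rewards 0 m w)%:E = mean_rewards m 0)%E.
  by rewrite (integral_rewards _ indep0 (a := 0))// probability_setT mul1e.
have HS k : (mean_rewards k 0 = 1 + \sum_(i < k) c%:E *
    PP (hit i.+1) * mean_rewards (k - i.+1) 0)%E.
  rewrite -[LHS]mul1e -(@probability_setT _ _ _ PP).
  rewrite -(integral_rewards k indep0 (a := 0))//.
  under eq_integral do rewrite rewards_expansion EFinD -sumEFin.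
  have mt (i : nat) : measurable_fun setT (fun w =>
      (c * (D i.+1 w == 0)%:R * rewards i.+1 (k - i.+1) w)%:E).
    apply/measurable_EFinP; apply: measurable_funM; last exact: measurable_rewards.
    apply: measurable_funM => //; exact: measurable_hit.
  have t0 (i : nat) w : (0 <= (c * (D i.+1 w == 0)%:R *
      rewards i.+1 (k - i.+1) w)%:E)%E.
    by rewrite lee_fin !mulr_ge0// rewards_ge0.
  rewrite ge0_integralD//; last 2 first.
  - by move=> w _; apply: sume_ge0 => i _; exact: t0.
  - by apply: emeasurable_sum => i; exact: mt.
  rewrite integral_cst// mul1e !probability_setT ge0_integral_sum//.
  congr (_ + _)%E; first exact: probability_setT.
  apply: eq_bigr => i _.
  rewrite -muleA -(integral_rewards _ (indep i)) => [|w //].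
  rewrite -ge0_integralZl//; last 2 first.
  - by apply/measurable_EFinP; apply: measurable_funTS; exact: measurable_rewards.
  - by move=> w _; rewrite lee_fin rewards_ge0.
  rewrite [RHS]integral_mkcond; apply: eq_integral => w _.
  rewrite patchE /hit; case: ifPn; rewrite ?inE ?notin_setE /= => Dw.
    by rewrite Dw eqxx mulr1 EFinM.
  by move/eqP/negbTE : Dw => ->; rewrite mulr0 mul0r.
suff H k : (k <= m)%N -> (mean_rewards k 0 <= ((1 - theta)^-1)%:E)%E by exact: H.
elim/ltn_ind: k => k IH km.
rewrite HS.
have th1 : 0 < 1 - theta by rewrite subr_gt0.
have PP0 i : (0 <= PP (hit i))%E by exact: measure_ge0.
apply: (@le_trans _ _ (1 + theta%:E * ((1 - theta)^-1)%:E)%E); last first.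
  rewrite -EFinM -EFinD lee_fin.
  suff -> : 1 + theta * (1 - theta)^-1 = (1 - theta)^-1 by [].
  by field; rewrite lt0r_neq0.
apply: leeD => //.
apply: (@le_trans _ _ ((c%:E * \sum_(i < k) PP (hit i.+1)) * ((1 - theta)^-1)%:E)%E).
  rewrite ge0_sume_distrr// ge0_sume_distrl => [|i _]; last exact: mule_ge0.
  apply: lee_sum => i _; apply: lee_wpmul2l; first exact: mule_ge0.
  by have ik := ltn_ord i; apply: IH; lia.
apply: lee_wpmul2r; first by rewrite lee_fin invr_ge0 ltW.
apply: le_trans Hc; apply: lee_wpmul2l => //.
rewrite -(big_mkord xpredT (fun i => PP (hit i.+1))).
rewrite -(big_mkord xpredT (fun i => PP (hit i.+1))).
rewrite (big_cat_nat (leq0n k) km)/= leeDl//.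
exact: sume_ge0.
Qed.

End khasminskii.

(** * Meetings of two walks along a grid *)

Section pair_skeleton.
Context {d : nat} {dT : measure_display} {T : measurableType dT} {R : realType}.
Variables (P : probability T R) (J : nat -> T -> R) (X : nat -> T -> lattice d).
Hypothesis hwalk : simple_random_walk P J X.
Hypothesis d_gt0 : (0 < d)%N.

Definition position (t : R) (w : T) : lattice d :=
  displacement X 0 (njumps J t w) w.

Definition separation (t : R) (p : T * T) : lattice d :=
  position t p.1 - position t p.2.

Definition pair_increment (r : nat -> R) (i : nat) (p : T * T) :
    lattice d * lattice d :=
  (increment J X r i p.1, increment J X r i p.2).

Lemma position_increment r i w : r i <= r i.+1 ->
  position (r i.+1) w = position (r i) w + increment J X r i w.
Proof.
move=> ri; rewrite /position /increment /jump_number.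
have := njumps_nd hwalk w ri; move: (njumps J (r i) w) (njumps J (r i.+1) w).
move=> a b ab; rewrite /displacement.
rewrite -!(big_mkord xpredT (fun k => X (0 + k)%N w)) (big_cat_nat (leq0n a) ab)/=.
congr (_ + _); rewrite -{1}(add0n a) big_addn big_mkord.
by apply: eq_bigr => k _; rewrite add0n addnC.
Qed.

Lemma measurable_fibers_position t : measurable_fibers (position t).
Proof.
apply: (@measurable_fibers_index _ _ _ _ (njumps J t) (fun n => displacement X 0 n)).
  exact: (measurable_fibers_njumps hwalk).
by move=> n z; exact: (measurable_displacement hwalk).
Qed.

Lemma measurable_fibers_fst {U : countType} (Y : T -> U) : measurable_fibers Y ->
  @measurable_fibers _ (T * T)%type _ (fun p => Y p.1).
Proof.
move=> mY u; rewrite -[X in measurable X]setTI.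
exact: measurable_fst measurableT _ (mY u).
Qed.

Lemma measurable_fibers_snd {U : countType} (Y : T -> U) : measurable_fibers Y ->
  @measurable_fibers _ (T * T)%type _ (fun p => Y p.2).
Proof.
move=> mY u; rewrite -[X in measurable X]setTI.
exact: measurable_snd measurableT _ (mY u).
Qed.

Lemma measurable_fibers_separation t : measurable_fibers (separation t).
Proof.
apply: (@measurable_fibers_pair _ _ _ _ _ _ _ (fun a b : lattice d => a - b)).
  exact: measurable_fibers_fst (measurable_fibers_position t).
exact: measurable_fibers_snd (measurable_fibers_position t).
Qed.

Lemma measurable_fibers_pair_increment r i : measurable_fibers (pair_increment r i).
Proof.
apply: (@measurable_fibers_pair _ _ _ _ _ _ _ (fun a b : lattice d => (a, b))).
  exact: measurable_fibers_fst (measurable_fibers_increment hwalk r i).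
exact: measurable_fibers_snd (measurable_fibers_increment hwalk r i).
Qed.

Definition pair_kernel (h : R) (u : lattice d * lattice d) : \bar R :=
  (heat_kernel h u.1 * heat_kernel h u.2)%E.

Lemma pair_kernel_ge0 h u : (0 <= pair_kernel h u)%E.
Proof. by apply: mule_ge0; exact: heat_kernel_ge0. Qed.

Lemma pair_skeleton_law (r : nat -> R) (m : nat) (u : nat -> lattice d * lattice d) :
  r 0%N = 0 -> (forall i, r i < r i.+1) ->
  walk_pair P (\bigcap_(i in `I_m) pair_increment r i @^-1` [set u i]) =
  (\prod_(i < m) pair_kernel (r i.+1 - r i) (u i))%E.
Proof.
move=> r0 r_incr.
have -> : \bigcap_(i in `I_m) pair_increment r i @^-1` [set u i] =
    (\bigcap_(i in `I_m) increment J X r i @^-1` [set (u i).1]) `*`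
    (\bigcap_(i in `I_m) increment J X r i @^-1` [set (u i).2]).
  apply/seteqP; split => p.
    by move=> H; split => i im; have := H i im; rewrite /pair_increment/= => <-.
  move=> [H1 H2] i im; rewrite /= /pair_increment (H1 i im) (H2 i im).
  by rewrite -surjective_pairing.
have mI z : measurable (\bigcap_(i in `I_m) increment J X r i @^-1` [set z i]).
  apply: fin_bigcap_measurable => // i _.
  exact: (measurable_fibers_increment hwalk r i (z i)).
transitivity (P (\bigcap_(i in `I_m) increment J X r i @^-1` [set (u i).1]) *
    P (\bigcap_(i in `I_m) increment J X r i @^-1` [set (u i).2]))%E.
  exact: product_measure1E.
by rewrite !(skeleton_law hwalk d_gt0)// -big_split.
Qed.

Variables (h : R) (r : nat -> R).
Hypothesis h_gt0 : 0 < h.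
Hypothesis r0 : r 0%N = 0.
Hypothesis r_step : forall i, r i.+1 - r i = h.
Local Notation D := (fun i : nat => separation (r i)).
Local Notation zeta := (pair_increment r).

Let r_incr i : r i < r i.+1.
Proof. by rewrite -subr_gt0 r_step. Qed.

Lemma separationS i p : D i.+1 p = D i p + ((zeta i p).1 - (zeta i p).2).
Proof.
rewrite /separation !(@position_increment r i)/=; [|exact: ltW|exact: ltW].
by rewrite opprD addrACA.
Qed.

Lemma separation0 p : D 0%N p = 0.
Proof.
rewrite /separation /position.
by rewrite !(njumps0 hwalk r0) /displacement !big_ord0 subrr.
Qed.

Lemma future_independent_start :
  future_independent (walk_pair P) zeta (pair_kernel h) 0 setT.
Proof.
split => // k u; rewrite setTI.
rewrite probability_setT mul1e.
apply: etrans (@pair_skeleton_law r k u r0 r_incr) _.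
by apply: eq_bigr => i _; move: (u i) => v; rewrite (r_step i).
Qed.

Let shift j i := if i is i'.+1 then r (j.+1 + i')%N else 0 : R.

Let shift_incr j i : shift j i < shift j i.+1.
Proof.
case: i => [|i] /=; first by rewrite addn0 -r0; elim: j => // j /lt_trans; exact.
by rewrite addnS.
Qed.

Let shift_increment0 j w : increment J X (shift j) 0 w = position (r j.+1) w.
Proof.
have := @position_increment (shift j) 0 w (ltW (shift_incr j 0)).
rewrite /= addn0 => ->; rewrite -[LHS]add0r; congr (_ + _).
by rewrite /position (@njumps0 _ _ _ _ _ _ _ hwalk (shift j))// /displacement big_ord0.
Qed.

(** The walks are described by another grid that starts directly with the cell
    [0, r (j + 1)], on which both walks have increment z, and continues with the
    remaining cells of r. The grid is shift j, and pair_skeleton_law applies to it. *)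
Lemma hit_future j k (u : nat -> lattice d * lattice d) (z : lattice d) :
  walk_pair P (([set p | D j.+1 p = 0] `&`
      \bigcap_(i in `I_k) zeta (j.+1 + i)%N @^-1` [set u i]) `&`
      (fun p => position (r j.+1) p.1) @^-1` [set z]) =
  (heat_kernel (r j.+1) z ^+ 2 * \prod_(i < k) pair_kernel h (u i))%E.
Proof.
pose v i := if i is i'.+1 then u i' else (z, z).
have kernelE : (\prod_(i < k.+1) pair_kernel (shift j i.+1 - shift j i) (v i) =
    heat_kernel (r j.+1) z ^+ 2 * \prod_(i < k) pair_kernel h (u i))%E.
  rewrite big_ord_recl (eq_bigr (fun i : 'I_k => pair_kernel h (u i))).
    by rewrite /pair_kernel /= addn0 subr0.
  move=> i _; rewrite lift0 /v; move: (u i) => v0.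
  by rewrite /shift addnS r_step.
rewrite -kernelE -(@pair_skeleton_law (shift j) k.+1 v erefl (shift_incr j)).
congr (walk_pair P _); apply/seteqP; split => p.
  move=> [[Dp H] /= pz] [|i] /= ik.
    rewrite /pair_increment !shift_increment0 pz.
    congr (_, _); apply/eqP; rewrite eq_sym -subr_eq0 -pz; exact/eqP.
  by have := H i ik; rewrite /pair_increment /increment /jump_number /= addnS.
move=> H; have [Hz1 Hz2] : position (r j.+1) p.1 = z /\ position (r j.+1) p.2 = z.
  have := H 0%N isT; rewrite /= /pair_increment !shift_increment0.
  by move=> [-> ->].
split; last exact: Hz1.
split; first by rewrite /= /separation Hz1 Hz2 subrr.
move=> i ik; have := H i.+1 ik.
by rewrite /pair_increment /increment /jump_number /= addnS.
Qed.

Lemma hit_probability j : walk_pair P [set p | D j.+1 p = 0] =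
  (\esum_(z in [set: lattice d]) heat_kernel (r j.+1) z ^+ 2)%E.
Proof.
rewrite -(@esum_measure_fibers _ _ _ _ _ (fun p => position (r j.+1) p.1)); last 2 first.
- exact: measurable_fibers_fst (measurable_fibers_position _).
- exact: measurable_fibers_separation.
apply: eq_esum => z _; have := hit_future j 0 (fun=> (0, 0)) z.
by rewrite (_ : `I_0 = set0) ?bigcap_set0 ?setIT ?big_ord0 ?mule1//; apply/seteqP; split.
Qed.

Lemma future_independent_hit j :
  future_independent (walk_pair P) zeta (pair_kernel h) j.+1 [set p | D j.+1 p = 0].
Proof.
have mD : measurable [set p | D j.+1 p = 0] by exact: measurable_fibers_separation.
split => // k u.
rewrite -(@esum_measure_fibers _ _ _ _ _ (fun p => position (r j.+1) p.1)); last 2 first.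
- exact: measurable_fibers_fst (measurable_fibers_position _).
- apply: measurableI => //; apply: fin_bigcap_measurable => // i _.
  exact: measurable_fibers_pair_increment.
transitivity (\esum_(z in [set: lattice d])
    (\prod_(i < k) pair_kernel h (u i) * heat_kernel (r j.+1) z ^+ 2))%E.
  apply: eq_esum => z _; apply: etrans (hit_future _ _ _ _) _; exact: muleC.
rewrite ge0_esumZl => [||z]; last exact: sqre_ge0.
  by rewrite muleC hit_probability.
by apply: prode_ge0 => i _; exact: pair_kernel_ge0.
Qed.

End pair_skeleton.

(** * The expected number of meetings *)

Section poisson_occupation.
Context {R : realType}.

Definition poisson_cdf (n : nat) (r : R) : R :=
  \sum_(k < n.+1) r ^+ k * k`!%:R^-1 * expR (- r).

Lemma is_derive_poisson_cdf n (r : R) :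
  is_derive r 1 (poisson_cdf n) (- (r ^+ n * n`!%:R^-1 * expR (- r))).
Proof.
have dexp (t : R) : is_derive t 1 (fun t : R => expR (- t)) (- expR (- t)).
  by apply: is_derive_eq; rewrite mulrN1.
elim: n => [|n IH].
  have -> : poisson_cdf 0 = fun t => expR (- t).
    by apply/funext => t; rewrite /poisson_cdf big_ord1 expr0 mul1r invr1 mul1r.
  by rewrite expr0 mul1r invr1 mul1r; exact: dexp.
have -> : poisson_cdf n.+1 = poisson_cdf n \+
    (fun t => t ^+ n.+1 * ((n.+1)`!%:R^-1 * expR (- t))).
  by apply/funext => t; rewrite /poisson_cdf big_ord_recr/= mulrA.
have dX : is_derive r 1 (fun t : R => t ^+ n.+1) (n.+1%:R * r ^+ n).
  apply: DeriveDef; first exact: exprn_derivable.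
  by rewrite exp_derive /GRing.scale/= mulr1.
have dE : is_derive r 1 (fun t : R => (n.+1)`!%:R^-1 * expR (- t))
    ((n.+1)`!%:R^-1 * - expR (- r)).
  by apply: is_derive_eq.
have dM := is_deriveM dX dE.
apply: is_derive_eq.
rewrite /GRing.scale/= factS natrM.
have n0 : (n`!%:R : R) != 0 by rewrite pnatr_eq0 -lt0n fact_gt0.
have n1 : (n.+1%:R : R) != 0 by rewrite pnatr_eq0.
rewrite exprS.
by field; rewrite n0 nat1r.
Qed.

Lemma poisson_pmf_total (r : R) : 0 < r ->
  (\sum_(n <oo) (poisson_pmf r n)%:E = 1)%E.
Proof.
move=> r0; rewrite nneseries_esumT => [|k]; last by rewrite lee_fin poisson_pmf_ge0.
transitivity (poisson_prob r 0%N [set: nat]); first by rewrite /poisson_prob r0.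
exact: (@probability_setT _ _ _ (poisson_prob r 0%N)).
Qed.

Lemma poisson_cdf_ge0 n r : 0 <= r -> 0 <= poisson_cdf n r.
Proof.
by move=> r0; apply: sumr_ge0 => k _; rewrite !mulr_ge0 ?exprn_ge0 ?expR_ge0.
Qed.

Lemma poisson_cdf_le1 n (r : R) : 0 < r -> poisson_cdf n r <= 1.
Proof.
move=> r0; rewrite -lee_fin -(poisson_pmf_total r0).
apply: le_trans (nneseries_lim_ge n.+1 _); last first.
  by move=> k _ _; rewrite lee_fin poisson_pmf_ge0.
rewrite sumEFin lee_fin big_mkord ler_sum// => k _.
by rewrite /poisson_pmf r0.
Qed.

(** By the mean value theorem the difference of cdfs is h times the density at a
    point c of [b, b + h]; there c ^ n >= b ^ n and exp (- c) >= exp (- b - h). *)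
Lemma poisson_pmf_cdf n (h b : R) : 0 < h -> 0 < b ->
  h * poisson_pmf b n <= expR h * (poisson_cdf n b - poisson_cdf n (b + h)).
Proof.
move=> h0 b0.
have bh : b < b + h by rewrite ltrDl.
have [//|c /[!in_itv]/= /andP[bc cb]] := @MVT R (poisson_cdf n) _ b (b + h) bh
  (fun r _ => is_derive_poisson_cdf n r).
  apply: derivable_within_continuous => r _.
  by have [] := is_derive_poisson_cdf n r.
rewrite [b + h - b]addrAC subrr add0r => /(congr1 -%R).
rewrite opprB => ->; rewrite mulNr opprK [expR h * _]mulrA [in leRHS]mulrC ler_pM2l//.
rewrite /poisson_pmf b0.
have -> : expR h * (c ^+ n * n`!%:R^-1 * expR (- c)) =
    (c ^+ n * n`!%:R^-1) * expR (h - c) by rewrite expRD; ring.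
apply: ler_pM; [|exact: expR_ge0| |].
- by rewrite mulr_ge0// exprn_ge0// ltW.
- rewrite ler_wpM2r// lerXn2r ?nnegrE ?ltW//; exact: lt_trans bc.
- by rewrite ler_expR; lra.
Qed.

(** The bounds poisson_pmf_cdf telescope along the multiples of h. *)
Lemma poisson_occupation n m (h : R) : 0 < h ->
  \sum_(i < m) poisson_pmf (i.+1%:R * h) n <= expR h / h.
Proof.
move=> h0; rewrite ler_pdivlMr// mulr_suml.
have b0 (k : nat) : 0 < k.+1%:R * h by rewrite mulr_gt0// ltr0n.
apply: (@le_trans _ _ (\sum_(i < m) expR h *
    (poisson_cdf n (i.+1%:R * h) - poisson_cdf n (i.+2%:R * h)))).
  apply: ler_sum => i _; rewrite mulrC.
  have := @poisson_pmf_cdf n h (i.+1%:R * h) h0 (b0 i).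
  by rewrite (_ : i.+1%:R * h + h = i.+2%:R * h)// -[in RHS]natr1 mulrDl mul1r.
rewrite -mulr_sumr ger_pMr ?expR_gt0//.
rewrite -(big_mkord xpredT (fun i => poisson_cdf n (i.+1%:R * h) - poisson_cdf n (i.+2%:R * h))).
rewrite (telescope_sumr_eq (fun i => - poisson_cdf n (i.+1%:R * h)))//; last first.
  by move=> i _; rewrite opprK addrC.
rewrite opprK addrC lerBlDr (le_trans (poisson_cdf_le1 n (b0 0%N)))//.
by rewrite lerDl poisson_cdf_ge0// ltW// b0.
Qed.

End poisson_occupation.

Section collisions.
Context {R : realType} {d : nat}.
Hypothesis d_gt0 : (0 < d)%N.
Local Notation q := (@srw_transition R d).

(** The probability that two independent discrete walks agree after n steps. *)
Definition return_mass (n : nat) : \bar R :=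
  (\esum_(z in [set: lattice d]) (q n z ^+ 2)%:E)%E.

Lemma srw_transition_le1 n z : q n z <= 1.
Proof.
elim: n z => [|n IH] z /=; first by rewrite lern1 leq_b1.
have d0 : 0 < (2 * d)%:R :> R by rewrite ltr0n muln_gt0.
rewrite ler_pdivrMl// mulr1.
apply: (@le_trans _ _ (\sum_(i < d) \sum_(b : bool) (1 : R))).
  by apply: ler_sum => i _; apply: ler_sum => b _.
by rewrite !sumr_const card_bool card_ord -mulrnA.
Qed.

(** Jensen's inequality for the square, the Poisson weights having total mass 1. *)
Lemma heat_kernel_sqr (r : R) (z : lattice d) : 0 < r ->
  (heat_kernel r z ^+ 2 <= \sum_(n <oo) (poisson_pmf r n * q n z ^+ 2)%:E)%E.
Proof.
move=> r0.
have pq0 n : (0 <= (poisson_pmf r n * q n z)%:E)%E.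
  by rewrite lee_fin mulr_ge0 ?poisson_pmf_ge0 ?srw_transition_ge0.
have p0 n : (0 <= (poisson_pmf r n)%:E :> \bar R)%E by rewrite lee_fin poisson_pmf_ge0.
have pq2 n : (0 <= (poisson_pmf r n * q n z ^+ 2)%:E :> \bar R)%E.
  by rewrite lee_fin mulr_ge0 ?poisson_pmf_ge0 ?exprn_ge0 ?srw_transition_ge0.
have le1 : (heat_kernel r z <= 1)%E.
  rewrite -(poisson_pmf_total r0); apply: lee_nneseries => // n _.
  by rewrite lee_fin ler_piMr ?poisson_pmf_ge0 ?srw_transition_le1.
have h0 : (0 <= heat_kernel r z)%E by apply: nneseries_ge0.
have hf : heat_kernel r z \is a fin_num.
  by rewrite ge0_fin_numE// (le_lt_trans le1)// ltry.
set p := fine (heat_kernel r z); have pE : heat_kernel r z = p%:E by rewrite fineK.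
have p_ge0 : 0 <= p by rewrite fine_ge0.
(* summing 2 p q <= q ^ 2 + p ^ 2 against the Poisson weights *)
have H : ((2 * p)%:E * heat_kernel r z <=
    \sum_(n <oo) (poisson_pmf r n * q n z ^+ 2)%:E + (p ^+ 2)%:E)%E.
  rewrite -[X in (_ + X)%E]mule1 -(poisson_pmf_total r0).
  rewrite -!ge0_nneseriesZl ?lee_fin ?mulr_ge0 ?exprn_ge0//.
  rewrite -nneseriesD//; last first.
    by move=> n _ _; rewrite mule_ge0// lee_fin exprn_ge0.
  apply: lee_nneseries => [n _ _|n _].
    by rewrite mule_ge0// lee_fin mulr_ge0.
  rewrite -!EFinM -EFinD lee_fin.
  have := mulr_ge0 (poisson_pmf_ge0 r n) (sqr_ge0 (q n z - p)); lra.
move: H; rewrite pE -EFinM -EFin_expe -leeBlDr// -EFinB.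
by rewrite (_ : 2 * p * p - p ^+ 2 = p ^+ 2); last ring.
Qed.

Lemma esum_heat_kernel_sqr (r : R) : 0 < r ->
  (\esum_(z in [set: lattice d]) heat_kernel r z ^+ 2 <=
   \sum_(n <oo) ((poisson_pmf r n)%:E * return_mass n))%E.
Proof.
move=> r0.
apply: (@le_trans _ _ (\esum_(z in [set: lattice d])
    \sum_(n <oo) (poisson_pmf r n * q n z ^+ 2)%:E)%E).
  by apply: le_esum => z _; exact: heat_kernel_sqr.
have a0 n z : (0 <= (poisson_pmf r n * q n z ^+ 2)%:E :> \bar R)%E.
  by rewrite lee_fin mulr_ge0 ?poisson_pmf_ge0 ?exprn_ge0 ?srw_transition_ge0.
rewrite esum_nneseries => [|z]; last exact: nneseries_ge0.
pose a k n := oapp (fun z : lattice d => (poisson_pmf r n * q n z ^+ 2)%:E) 0%E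
  (choice.pickle_inv k).
have -> : (\sum_(k <oo) oapp (fun z : lattice d =>
    \sum_(n <oo) (poisson_pmf r n * q n z ^+ 2)%:E) 0 (choice.pickle_inv k) =
    \sum_(k <oo) \sum_(n <oo) a k n)%E.
  apply: eq_eseriesr => k _; rewrite /a; case: (choice.pickle_inv k) => //=.
  by rewrite eseries0.
rewrite nneseries_interchange => [|k n]; last first.
  by rewrite /a; case: (choice.pickle_inv k) => /=.
rewrite le_eqVlt; apply/orP; left; apply/eqP; apply: eq_eseriesr => n _.
rewrite -ge0_esumZl => [||z]; last by rewrite lee_fin exprn_ge0 ?srw_transition_ge0.
  rewrite esum_nneseries => [|z]; last by rewrite mule_ge0 ?lee_fin ?poisson_pmf_ge0 ?exprn_ge0 ?srw_transition_ge0.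
  by apply: eq_eseriesr => k _; rewrite /a; case: (choice.pickle_inv k).
by rewrite lee_fin poisson_pmf_ge0.
Qed.

Lemma return_mass_ge0 n : (0 <= return_mass n)%E.
Proof. by apply: esum_ge0 => z _; rewrite lee_fin exprn_ge0 ?srw_transition_ge0. Qed.

Lemma return_mass0 : return_mass 0 = 1%E.
Proof.
rewrite /return_mass (esumID [set 0]); last first.
  by move=> z _; rewrite lee_fin exprn_ge0 ?srw_transition_ge0.
rewrite setTI esum_set1 ?lee_fin//= eqxx expr1n.
rewrite esum1 ?adde0// => z [_ /= /eqP/negbTE ->].
by rewrite expr0n.
Qed.

Lemma return_mass_total : (\sum_(n <oo) return_mass n = 1 + alpha R d)%E.
Proof.
rewrite /alpha (nneseries_recl (f := return_mass))//.
  by rewrite return_mass0.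
by move=> n _; exact: return_mass_ge0.
Qed.

Lemma expected_collisions (h : R) m : 0 < h ->
  (\sum_(i < m) \esum_(z in [set: lattice d]) heat_kernel (i.+1%:R * h) z ^+ 2 <=
   (expR h / h)%:E * (1 + alpha R d))%E.
Proof.
move=> h0.
have b0 (k : nat) : 0 < k.+1%:R * h by rewrite mulr_gt0// ltr0n.
apply: (@le_trans _ _ (\sum_(i < m) \sum_(n <oo)
    ((poisson_pmf (i.+1%:R * h) n)%:E * return_mass n))%E).
  by apply: lee_sum => i _; exact: esum_heat_kernel_sqr.
have t0 i n : (0 <= (poisson_pmf (i.+1%:R * h) n)%:E * return_mass n)%E.
  by rewrite mule_ge0 ?return_mass_ge0// lee_fin poisson_pmf_ge0.
rewrite -nneseries_sum//.
rewrite -return_mass_total -ge0_nneseriesZl; last 2 first.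
- by rewrite lee_fin divr_ge0 ?expR_ge0 ?ltW.
- exact: return_mass_ge0.
apply: lee_nneseries => [n _ _|n _]; first exact: sume_ge0.
rewrite -ge0_sume_distrl => [|i _]; last by rewrite lee_fin poisson_pmf_ge0.
apply: lee_wpmul2r; first exact: return_mass_ge0.
by rewrite sumEFin lee_fin poisson_occupation.
Qed.

End collisions.

(** * The time spent together as a Riemann sum *)

Section riemann_sums.
Context {R : realType}.

(** At most one cell of the grid meets [a, b[ without having its right endpoint
    in it: the cell in which b lies. *)
Lemma box_riemann (a b h : R) (n : nat) : 0 <= a -> 0 < h ->
  Num.max 0 (Num.min (n%:R * h) b - a) <=
  h * (\sum_(i < n) (a <= i.+1%:R * h < b)%R%:R) + h.
Proof.
move=> a0 h0.
have S0 : 0 <= h * (\sum_(i < n) (a <= i.+1%:R * h < b)%R%:R) + h.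
  by rewrite addr_ge0 ?(ltW h0)// mulr_ge0 ?(ltW h0)// sumr_ge0.
rewrite ge_max S0/=.
have [ba|ab] := leP b a.
  by apply: le_trans S0; rewrite subr_le0 ge_min ba orbT.
(* the grid point i h clamped to [a, b]: its increments add up to the length of the
   part of [a, b[ before n h *)
pose cl (i : nat) := Num.min b (Num.max a (i%:R * h)).
have clE : Num.min (n%:R * h) b - a <= cl n - cl 0%N.
  have -> : cl 0%N = a by rewrite /cl mul0r max_l// min_r// ltW.
  by rewrite lerD2r /cl minC le_min ge_min lexx/= !(ge_min, le_max) lexx !orbT.
apply: (le_trans clE).
rewrite -telescope_sumr// big_mkord.
apply: (@le_trans _ _ (\sum_(i < n) (h * (a <= i.+1%:R * h < b)%R%:R +
    h * ((b <= i.+1%:R * h)%R%:R - (b <= i%:R * h)%R%:R)))).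
  apply: ler_sum => i _; rewrite /cl.
  have e : i.+1%:R * h = i%:R * h + h by rewrite -natr1 mulrDl mul1r.
  rewrite e; move: (i%:R * h) => t {e}.
  have [bt|tb] := leP b t.
    have bt' : b <= t + h by lra.
    rewrite bt' ltNge bt' andbF/= subrr !mulr0 addr0.
    have [|] := leP a t; have [|] := leP a (t + h) => *; rewrite !min_l ; lra.
  have [bt'|tb'] := leP b (t + h).
    rewrite andbF/= mulr0 add0r subr0 mulr1 min_l; last by rewrite le_max bt' orbT.
    have : a <= Num.min b (Num.max a t) by rewrite le_min (ltW ab) le_max lexx.
    have : t <= Num.min b (Num.max a t) by rewrite le_min (ltW tb) le_max lexx orbT.
    by lra.
  rewrite andbT/= subrr mulr0 addr0.
  have [at_|at_] := leP a (t + h); last first.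
    by rewrite (max_l (_ : t <= a)) ?subrr ?mulr0//; lra.
  rewrite mulr1 min_r; last exact: ltW.
  have : t <= Num.min b (Num.max a t) by rewrite le_min (ltW tb) le_max lexx orbT.
  by lra.
rewrite big_split/= -!mulr_sumr lerD2l ger_pMr//.
rewrite -(big_mkord xpredT (fun i : nat => (b <= i.+1%:R * h)%R%:R - (b <= i%:R * h)%R%:R)).
rewrite (@telescope_sumr _ _ _ (fun i : nat => (b <= i%:R * h)%R%:R))//.
by move: (b <= n%:R * h) (b <= 0 * h) => [] [] /=; lra.
Qed.

Lemma sum_pick_le (n k : nat) (F : nat -> R) : (forall i, 0 <= F i) ->
  \sum_(i < n) ((i : nat) == k)%:R * F i <= F k.
Proof.
move=> F0; have [kn|nk] := ltnP k n.
  rewrite (bigD1 (Ordinal kn))//= eqxx mul1r big1 ?addr0// => i ik.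
  by rewrite -val_eqE/= in ik; rewrite (negbTE ik) mul0r.
rewrite big1// => i _; rewrite ltn_eqF ?mul0r//.
exact: leq_trans (ltn_ord i) nk.
Qed.

End riemann_sums.

Section common_time_riemann.
Context {d : nat} {dT : measure_display} {T : measurableType dT} {R : realType}.
Variables (P : probability T R) (J : nat -> T -> R) (X : nat -> T -> lattice d).
Hypothesis hwalk : simple_random_walk P J X.
Variables (x : lattice d) (s : R).

Lemma arrival_timeP (t : R) k w : 0 <= t ->
  (arrival_time J s k w <= s + t < arrival_time J s k.+1 w) = (k == njumps J t w).
Proof.
move=> t0.
have -> : (s + t < arrival_time J s k.+1 w) = ~~ (k < njumps J t w)%N.
  by rewrite -(njumpsP hwalk) /= ltrD2l ltNge.
have -> : (arrival_time J s k w <= s + t) = (k <= njumps J t w)%N.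
  case: k => [|k] /=; first by rewrite lerDl t0.
  by rewrite lerD2l (njumpsP hwalk).
by rewrite -leqNgt eqn_leq.
Qed.

(** At time (i + 1) h the two walks lie in at most one of the pairs of boxes, so
    the number of grid points in the boxes with equal sites is at most the number of
    meetings on the grid; each of the (N + 1) ^ 2 pairs of boxes costs an error h. *)
Lemma common_time_riemann N n (h : R) w w' : 0 < h ->
  common_time J X x s N (s + n%:R * h) w w' <=
  h * (\sum_(i < n) (separation J X (i.+1%:R * h) (w, w') == 0)%:R) +
  h * (N.+1 ^ 2)%:R.
Proof.
move=> h0.
pose dlt (j k : nat) : R := (site x (X ^~ w) j == site x (X ^~ w') k)%:R.
pose n1 i := njumps J (i.+1%:R * h) w; pose n2 i := njumps J (i.+1%:R * h) w'.
pose pk i (j k : nat) : R := (j == n1 i)%:R * ((k == n2 i)%:R * dlt j k).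
apply: (@le_trans _ _ (\sum_(j < N.+1) \sum_(k < N.+1)
    (h * (\sum_(i < n) pk i j k) + h))).
  apply: ler_sum => j _; apply: ler_sum => k _.
  rewrite -/(dlt j k).
  pose a := Num.max (arrival_time J s j w) (arrival_time J s k w') - s.
  pose b := Num.min (arrival_time J s j.+1 w) (arrival_time J s k.+1 w') - s.
  have ge_s l v : s <= arrival_time J s l v.
    case: l => //= l; rewrite lerDl ltW//; exact: (jump_time_gt0 hwalk).
  have a0 : 0 <= a by rewrite subr_ge0 le_max ge_s.
  have -> : Num.min (s + n%:R * h) (Num.min (arrival_time J s j.+1 w)
     (arrival_time J s k.+1 w')) - Num.max (arrival_time J s j w) (arrival_time J s k w')
     = Num.min (n%:R * h) b - a.
    rewrite /a /b opprB addrA; congr (_ - _).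
    by rewrite addr_minl subrK addrC.
  apply: (@le_trans _ _ (dlt j k * (h * (\sum_(i < n) (a <= i.+1%:R * h < b)%R%:R) + h))).
    by apply: ler_wpM2l; [rewrite /dlt|exact: box_riemann].
  rewrite mulrDr; apply: lerD; last by rewrite /dlt; case: (_ == _); rewrite ?mul1r// mul0r ltW.
  rewrite mulrCA ler_pM2l// mulr_sumr; apply: ler_sum => i _.
  have t0 : 0 <= i.+1%:R * h by rewrite mulr_ge0// ltW.
  rewrite /pk /n1 /n2 -!arrival_timeP// /a /b lerBlDl ltrBrDl ge_max lt_min.
  by rewrite andbACA -mulnb natrM [leLHS]mulrC mulrA.
under eq_bigr do rewrite big_split/=.
rewrite big_split/=; apply: lerD; last first.
  rewrite !sumr_const !card_ord -mulrnA mulnn.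
  by rewrite mulr_natr.
under eq_bigr do rewrite -mulr_sumr.
rewrite -mulr_sumr ler_pM2l//.
have -> : \sum_(j < N.+1) \sum_(k < N.+1) \sum_(i < n) pk i j k =
    \sum_(i < n) \sum_(j < N.+1) \sum_(k < N.+1) pk i j k.
  by rewrite [RHS]exchange_big; apply: eq_bigr => j _; exact: exchange_big.
apply: ler_sum => i _.
under eq_bigr do rewrite /pk -mulr_sumr.
apply: le_trans (@sum_pick_le R _ _
  (fun j => \sum_(k < N.+1) ((k : nat) == n2 i)%:R * dlt j k) _) _.
  by move=> j; apply: sumr_ge0 => k _; rewrite mulr_ge0 ?ler0n.
apply: le_trans (@sum_pick_le R _ _ (dlt (n1 i)) _) _ => [k|].
  by rewrite /dlt ler0n.
rewrite /dlt /site /separation /position /displacement.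
by rewrite (inj_eq (addrI x)) subr_eq0.
Qed.

End common_time_riemann.

(** * Boundedness of the second moment *)

Section second_moment.
Context {d : nat} {dT : measure_display} {T : measurableType dT} {R : realType}.
Variables (P : probability T R) (J : nat -> T -> R) (X : nat -> T -> lattice d).
Hypothesis hwalk : simple_random_walk P J X.
Hypothesis d_gt0 : (0 < d)%N.
Variables (Q : probability (path_space d R) R).
Hypothesis HQ : wiener_environment Q.
Variables (beta : R) (x : lattice d) (s : R).
Hypothesis beta_gt0 : 0 < beta.
Variable a : R.
Hypothesis alphaE : alpha R d = a%:E.

Lemma exhausting_jump (m : R) (w w' : T) :
  exists2 N, m <= s + J N w & m <= s + J N w'.
Proof.
have [N1 HN1] := jump_time_unbounded hwalk w (m - s).
have [N2 HN2] := jump_time_unbounded hwalk w' (m - s).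
have J_homo v i j : (i <= j)%N -> J i v <= J j v.
  apply: (@homo_leq _ (J ^~ v) _ lexx le_trans) => k.
  exact: ltW (poisson_increasing (walk_jump_times hwalk) v k).
exists (maxn N1 N2); rewrite -lerBlDl.
  by rewrite (le_trans (ltW HN1))// J_homo// leq_maxl.
by rewrite (le_trans (ltW HN2))// J_homo// leq_maxr.
Qed.

(** Only the common time before min t u enters the formula for the correlation. *)
Lemma pair_correlation_min t u p : s < t -> s < u ->
  pair_correlation J X Q beta x s t u p =
  pair_correlation J X Q beta x s (Num.min t u) (Num.min t u) p.
Proof.
move=> st su; case: p => w w'.
have [N tN tN'] := exhausting_jump (Num.max t u) w w'.
have [t1 u1] : t <= s + J N w /\ u <= s + J N w'.
  by move: tN tN'; rewrite !ge_max => /andP[-> _] /andP[_ ->].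
have sm : s < Num.min t u by rewrite lt_min st su.
rewrite (pair_correlationE hwalk HQ _ _ st su t1 u1).
rewrite (@pair_correlationE _ _ _ _ _ _ _ hwalk _ HQ _ _ _ _ _ _ _ N sm sm) ?minxx//.
  by rewrite (le_trans _ t1)// ge_min lexx.
by rewrite (le_trans _ u1)// ge_min lexx orbT.
Qed.

Lemma pair_correlation_nd t u p : s < t -> t <= u ->
  (pair_correlation J X Q beta x s t t p <=
   pair_correlation J X Q beta x s u u p)%E.
Proof.
move=> st tu; case: p => w w'; have su := lt_le_trans st tu.
have [N uN uN'] := exhausting_jump u w w'.
rewrite (pair_correlationE hwalk HQ _ _ su su uN uN').
rewrite (pair_correlationE hwalk HQ _ _ st st (le_trans tu uN) (le_trans tu uN')).
by rewrite !minxx lee_fin ler_expR ler_wpM2l ?sqr_ge0// common_time_nd.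
Qed.

Definition collision_count (h : R) (m : nat) (p : T * T) : R :=
  \sum_(i < m) (separation J X (i.+1%:R * h) p == 0)%:R.

Lemma measurable_collision_count h m :
  measurable_fun setT (collision_count h m).
Proof.
apply: measurable_sum => i.
rewrite (_ : (fun w => _) =
  (\1_[set p | separation J X (i.+1%:R * h) p = 0] : T * T -> R)).
  apply: measurable_indic; exact: (measurable_fibers_separation hwalk).
apply/funext => p; rewrite indicE; congr (_%:R); congr nat_of_bool.
by apply/eqP/idP; rewrite inE.
Qed.

(** With c = exp (beta ^ 2 h) - 1, the exponential is the product of the rewards of
    the difference of the two walks along the grid. *)
Lemma collision_mgf (h theta : R) (m : nat) : 0 < h -> theta < 1 ->
  (expR (beta ^+ 2 * h) - 1) * (expR h / h * (1 + a)) <= theta ->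
  (\int[walk_pair P]_p (expR (beta ^+ 2 * (h * collision_count h m p)))%:E <=
   ((1 - theta)^-1)%:E)%E.
Proof.
move=> h0 theta1 Hth.
pose r (i : nat) := i%:R * h.
have r0 : r 0%N = 0 by rewrite /r mul0r.
have r_step i : r i.+1 - r i = h by rewrite /r -natr1 mulrDl mul1r addrAC subrr add0r.
have c0 : 0 <= expR (beta ^+ 2 * h) - 1.
  by rewrite subr_ge0 -expR0 ler_expR mulr_ge0 ?sqr_ge0// ltW.
have key := khasminskii (measurable_fibers_pair_increment hwalk r)
  (g := fun z : lattice d * lattice d => z.1 - z.2) (separationS hwalk h0 r_step)
  (@pair_kernel_ge0 d R h) (fun i => measurable_fibers_separation hwalk (r i) 0)
  c0 (m := m) (separation0 hwalk r0)
  (future_independent_start hwalk d_gt0 h0 r0 r_step)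
  (future_independent_hit hwalk d_gt0 h0 r0 r_step) theta1.
apply: le_trans (key _).
  rewrite le_eqVlt; apply/orP; left; apply/eqP; apply: eq_integral => p _.
  congr EFin; rewrite /rewards mulrA /collision_count mulr_sumr expR_sum.
  apply: eq_bigr => i _; rewrite /reward add0n -/(r i.+1).
  by case: (_ == _); rewrite ?mulr1 ?mulr0 ?addr0 ?expR0// addrC subrK.
apply: (@le_trans _ _ ((expR (beta ^+ 2 * h) - 1)%:E * ((expR h / h)%:E * (1 + a%:E)))%E).
  apply: lee_wpmul2l; first by rewrite lee_fin.
  rewrite -alphaE; apply: le_trans (expected_collisions d_gt0 m h0).
  by apply: lee_sum => i _; rewrite (hit_probability hwalk d_gt0 h0 r0 r_step).
by rewrite -EFinD -!EFinM lee_fin.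
Qed.

(** As exp x - 1 <= x exp x, the left-hand side is at most
    beta ^ 2 (1 + a) exp ((beta ^ 2 + 1) h). *)
Lemma mesh_exists : 0 <= a -> beta ^+ 2 * (1 + a) < 1 ->
  exists2 theta : R, theta < 1 & exists2 h0 : R, 0 < h0 &
  forall h, 0 < h -> h <= h0 ->
  (expR (beta ^+ 2 * h) - 1) * (expR h / h * (1 + a)) <= theta.
Proof.
move=> a0; set k := beta ^+ 2; set rho := k * (1 + a) => rho1.
have k0 : 0 < k by rewrite exprn_gt0.
have a1 : 0 < 1 + a by rewrite ltr_pwDl.
have rho0 : 0 < rho by rewrite mulr_gt0.
exists ((1 + rho) / 2); first lra.
have ratio : 1 < (1 + rho) / 2 / rho by rewrite ltr_pdivlMr//; lra.
exists (ln ((1 + rho) / 2 / rho) / (k + 1)).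
  by rewrite divr_gt0 ?ln_gt0// addr_gt0.
move=> h h0 hle.
have e1 : expR (k * h) - 1 <= k * h * expR (k * h).
  have := expR_ge1Dx (- (k * h)).
  rewrite -(ler_pM2r (expR_gt0 (k * h))) -expRD addNr expR0 mulrDl mul1r mulNr.
  lra.
have Eh : expR h / h * (1 + a) >= 0 by rewrite mulr_ge0 ?divr_ge0 ?expR_ge0 ?(ltW h0)// ltW.
apply: le_trans (ler_wpM2r Eh e1) _.
have -> : k * h * expR (k * h) * (expR h / h * (1 + a)) = rho * expR ((k + 1) * h).
  rewrite mulrDl mul1r expRD /rho; field; exact: lt0r_neq0.
have -> : (1 + rho) / 2 = rho * expR (ln ((1 + rho) / 2 / rho)).
  by rewrite lnK ?posrE ?(lt_trans ltr01)// [RHS]mulrC divfK// lt0r_neq0.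
rewrite ler_pM2l//.
by rewrite ler_expR mulrC -ler_pdivlMr// addr_gt0.
Qed.

(** Fatou's lemma along the meshes (m - s) / n. On a fixed pair of paths the
    error in common_time_riemann tends to 0, since N does not depend on the mesh.
    The truncation by G makes the integrands converge instead of just being bounded
    from below in the limit. *)
Lemma pair_correlation_bounded : 0 <= a -> beta ^+ 2 * (1 + a) < 1 ->
  exists C : R, forall m, s < m ->
  (\int[walk_pair P]_p pair_correlation J X Q beta x s m m p <= C%:E)%E.
Proof.
move=> a0 rho1; have [theta theta1 [h0 h0_gt0 Hmesh]] := mesh_exists a0 rho1.
exists (1 - theta)^-1 => m sm.
have ms : 0 < m - s by rewrite subr_gt0.
(* n0 is added to the number of cells so that all meshes are at most h0 *)
pose n0 := Num.truncn ((m - s) / h0).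
pose len (n : nat) := (n + n0).+1.
pose h n := (m - s) / (len n)%:R.
have len0 n : 0 < (len n)%:R :> R by rewrite ltr0n.
have h_gt0 n : 0 < h n by rewrite divr_gt0.
have h_le n : h n <= h0.
  rewrite /h ler_pdivrMr// mulrC -ler_pdivrMr//.
  apply: ltW; apply: lt_le_trans (truncnS_gt _) _.
  by rewrite ler_nat ltnS leq_addl.
have hm n : s + (len n)%:R * h n = m.
  by rewrite /h mulrC divfK ?subrKC// lt0r_neq0.
pose G := pair_correlation J X Q beta x s m m.
pose E n p : R := expR (beta ^+ 2 * (h n * collision_count (h n) (len n) p)).
pose u n p : \bar R := mine (G p) (E n p)%:E.
have mG : measurable_fun setT G by exact: (measurable_pair_correlation hwalk HQ).
have mE n : measurable_fun setT (fun p => (E n p)%:E).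
  apply/measurable_EFinP; apply: measurableT_comp => //.
  apply: measurable_funM => //; apply: measurable_funM => //.
  exact: measurable_collision_count.
have G0 p : (0 <= G p)%E by apply: integral_ge0 => om _; exact: pair_weight_ge0.
apply: (@ae_fatou _ _ _ _ G u (cst ((1 - theta)^-1)%:E)).
- exact: mG.
- by move=> n; exact: measurable_mine.
- by move=> n p; rewrite /u le_min G0 lee_fin expR_ge0.
- apply: aeW => -[w w'].
  have [N N1N N2N] := exhausting_jump m w w'.
  pose L := common_time J X x s N m w w'.
  have GE : G (w, w') = (expR (beta ^+ 2 * L))%:E.
    by rewrite /G (pair_correlationE hwalk HQ beta x sm sm N1N N2N) minxx.
  have -> : u ^~ (w, w') = fun n => (Num.min (expR (beta ^+ 2 * L)) (E n (w, w')))%:E.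
    by apply/funext => n; rewrite /u GE EFin_min.
  rewrite GE; apply/cvg_EFin; first by apply: nearW.
  pose K := beta ^+ 2 * (m - s) * (N.+1 ^ 2)%:R.
  apply: (@squeeze_cvgr _ _ _ _
    (fun n : nat => expR (beta ^+ 2 * L - K / (len n)%:R)) (fun=> expR (beta ^+ 2 * L))).
  + apply: nearW => n /=; rewrite ge_min lexx/= andbT le_min; apply/andP; split.
      rewrite ler_expR gerBl divr_ge0// !mulr_ge0 ?sqr_ge0//; exact: ltW.
    have -> : K / (len n)%:R = beta ^+ 2 * (h n * (N.+1 ^ 2)%:R) by rewrite /K /h; ring.
    rewrite ler_expR lerBlDr -mulrDr ler_pM2l ?exprn_gt0//.
    have := common_time_riemann hwalk x s N (len n) w w' (h_gt0 n).
    by rewrite hm.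
  + apply: continuous_cvg; first exact: continuous_expR.
    rewrite -[X in _ --> X]subr0; apply: cvgB; first exact: cvg_cst.
    rewrite -(mulr0 K); apply: cvgMr.
    have : (k.+1%:R^-1 : R) @[k --> \oo] --> 0 by exact: cvg_harmonic.
    by rewrite -(cvg_shiftn n0).
  + exact: cvg_cst.
- move=> n; apply: le_trans (collision_mgf (len n) (h_gt0 n) theta1 (Hmesh _ (h_gt0 n) (h_le n))).
  apply: ge0_le_integral => //.
  + by move=> p _; rewrite /u le_min G0 lee_fin expR_ge0.
  + exact: measurable_mine.
  + exact: mE.
  + by move=> p _; rewrite /u ge_min lexx orbT.
- exact: cvg_cst.
Qed.

End second_moment.

(** * The smallness condition *)

Section small_disorder.
Context {R : realType}.

Lemma exponential_expectation (f : R -> R) :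
  measurable_fun setT f -> (forall x, 0 <= f x) ->
  (\int[exponential_prob (1 : R)]_x (f x)%:E =
   \int[lebesgue_measure]_x ((exponential_pdf (1 : R) x)%:E * (f x)%:E))%E.
Proof.
move=> mf f0.
pose nu := exponential_distribution_exponential_prob__canonical__measure_function_SigmaFiniteMeasure (@ltr01 R).
apply: (@ge0_integral_density _ _ _ lebesgue_measure nu
  (fun x => (exponential_pdf (1 : R) x)%:E) f) => //.
- by apply/measurable_EFinP; exact: measurable_exponential_pdf.
- by move=> x; rewrite lee_fin exponential_pdf_ge0.
Qed.

(** A lower bound valid for all beta, hence also for beta >= 1, where lambda is
    infinite: exp (b x) times the exponential density of rate 1 is that of rate
    1 - b divided by 1 - b, so the right-hand side is the integral of
    exp (b x) - 1. *)
Lemma lambda_ge (beta b : R) : 0 < b -> b < 1 -> b <= beta ^+ 2 ->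
  ((b / (1 - b))%:E <= lambda beta)%E.
Proof.
move=> b0 b1 bbeta; have b1' : 0 < 1 - b by rewrite subr_gt0.
pose f tau := expR (beta ^+ 2 * tau) - 1.
have mf : measurable_fun setT f.
  apply: measurable_funB => //; apply: measurableT_comp => //.
(* f is negative on negative times, which the exponential law does not charge *)
pose fp x := Num.max (f x) 0; pose fn x := Num.max (- f x) 0.
have fp0 x : 0 <= fp x by rewrite le_max lexx orbT.
have fn0 x : 0 <= fn x by rewrite le_max lexx orbT.
have mfp : measurable_fun setT fp by apply: measurable_maxr.
have mfn : measurable_fun setT fn by apply: measurable_maxr => //; exact: measurableT_comp.
have p0 (r x : R) : 0 <= r -> (0 <= (exponential_pdf r x)%:E)%E.
  by move=> r0; rewrite lee_fin exponential_pdf_ge0.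
have mpdf r : measurable_fun setT (fun x => (exponential_pdf (r : R) x)%:E).
  by apply/measurable_EFinP; exact: measurable_exponential_pdf.
have mprod : measurable_fun setT (fun x => (exponential_pdf (1 : R) x)%:E * (fp x)%:E)%E.
  by apply: emeasurable_funM; [exact: mpdf|exact/measurable_EFinP].
have negE : (\int[exponential_prob (1 : R)]_x (fn x)%:E = 0)%E.
  rewrite exponential_expectation//; apply: integral0_eq => x _.
  have [x0|x0] := ltP x 0; first by rewrite lt0_exponential_pdf// mul0e.
  rewrite /fn max_r ?mule0// oppr_le0 /f subr_ge0 -expR0 ler_expR.
  by rewrite mulr_ge0 ?sqr_ge0.
have -> : (lambda beta = \int[lebesgue_measure]_x
    ((exponential_pdf (1 : R) x)%:E * (fp x)%:E))%E.
  rewrite /lambda integralE.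
  rewrite [X in (_ - X)%E](_ : _ = \int[exponential_prob (1 : R)]_x (fn x)%:E)%E; last first.
    by apply: eq_integral => x _; rewrite funenegE /fn EFin_max.
  rewrite negE sube0 -exponential_expectation//.
  by apply: eq_integral => x _; rewrite funeposE /fp EFin_max.
(* exp (b x) times the density of rate 1 is the density of rate 1 - b divided by 1 - b *)
have le_pdf : (((1 - b)^-1)%:E * \int[lebesgue_measure]_x (exponential_pdf (1 - b) x)%:E <=
    \int[lebesgue_measure]_x ((exponential_pdf (1 : R) x)%:E * (fp x)%:E) +
    \int[lebesgue_measure]_x (exponential_pdf (1 : R) x)%:E)%E.
  rewrite -ge0_integralD//; last 3 first.
  - by move=> x _; rewrite mule_ge0 ?lee_fin// exponential_pdf_ge0.
  - by move=> x _; exact: p0.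
  - exact: mpdf.
  rewrite -ge0_integralZl//; last 3 first.
  - exact: mpdf.
  - by move=> x _; rewrite p0// ltW.
  - by rewrite lee_fin invr_ge0 ltW.
  apply: ge0_le_integral => //.
  - by move=> x _; rewrite mule_ge0 ?p0 ?(ltW b1')// lee_fin invr_ge0 ltW.
  - exact: (emeasurable_funM (measurable_cst _) (mpdf (1 - b))).
  - exact: (emeasurable_funD mprod (mpdf 1)).
  move=> x _; rewrite -!EFinM -EFinD lee_fin.
  have [x0|x0] := ltP x 0; first by rewrite !lt0_exponential_pdf// mulr0 mul0r addr0.
  rewrite !exponential_pdfE// mulrA mulVf ?lt0r_neq0// !mul1r.
  rewrite -[X in _ <= _ + X]mulr1 -mulrDr.
  apply: (@le_trans _ _ (expR (-1 * x) * expR (b * x))).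
    by rewrite -expRD -mulrDl opprB addrC.
  rewrite ler_pM2l ?expR_gt0// -lerBlDr le_max; apply/orP; left.
  by rewrite /f lerD2r ler_expR ler_wpM2r.
move: le_pdf; rewrite !integral_exponential_pdf// mule1 => H.
rewrite (_ : b / (1 - b) = (1 - b)^-1 - 1); last by field; exact: lt0r_neq0.
by rewrite EFinB leeBlDr.
Qed.

End small_disorder.

Section small_disorder_alpha.
Context {R : realType} {d : nat}.
Hypothesis d_gt0 : (0 < d)%N.

(** The walk has positive probability to make a given first step. *)
Lemma alpha_gt0 : (0 < alpha R d)%E.
Proof.
pose e : lattice d := unit_step (Ordinal d_gt0) false.
have d0 : 0 < (2 * d)%:R :> R by rewrite ltr0n muln_gt0.
have q0 : 0 < srw_transition R 1 e.
  rewrite /= mulr_gt0 ?invr_gt0// (bigD1 (Ordinal d_gt0))//= big_bool/= -/e.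
  rewrite [e - e]subrr eqxx addrAC addrC ltr_pwDl// addr_ge0 ?ler0n// sumr_ge0// => i _.
  by apply: sumr_ge0 => c _; rewrite ler0n.
have s0 n : (0 <= @return_mass R d n)%E by exact: return_mass_ge0.
apply: (@lt_le_trans _ _ (return_mass 1)).
  apply: (@lt_le_trans _ _ (srw_transition R 1 e ^+ 2)%:E).
    by rewrite lte_fin exprn_gt0.
  rewrite -(esum_set1 (t := e) (a := fun z => (srw_transition R 1 z ^+ 2)%:E)).
    rewrite esum_mkcond; apply: le_esum => z _.
    by case: ifP => // _; rewrite lee_fin sqr_ge0.
  by rewrite lee_fin sqr_ge0.
rewrite /alpha.
apply: le_trans (nneseries_lim_ge 2 _) => [|n _ _]; last exact: s0.
by rewrite big_nat1.
Qed.

(** If beta ^ 2 (1 + a) were at least 1, then b = 1 / (1 + a) would be admissible in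
    lambda_ge, and a b / (1 - b) = 1. *)
Lemma small_disorder (beta : R) : 0 < beta ->
  (alpha R d * lambda beta < 1)%E ->
  exists a : R, [/\ alpha R d = a%:E, 0 <= a & beta ^+ 2 * (1 + a) < 1].
Proof.
move=> beta0 Hab; have al0 := alpha_gt0.
have lam_gt0 : (0 < lambda beta)%E.
  pose b : R := Num.min (beta ^+ 2) 2^-1.
  have b0 : 0 < b by rewrite lt_min exprn_gt0//= invr_gt0 ltr0n.
  have b1 : b < 1 by rewrite gt_min invf_lt1 ?ltr1n ?orbT.
  apply: (@lt_le_trans _ _ (b / (1 - b))%:E).
    by rewrite lte_fin divr_gt0// subr_gt0.
  by apply: lambda_ge => //; rewrite ge_min lexx.
have alf : alpha R d \is a fin_num.
  rewrite gt0_fin_numE// ltey; apply/eqP => aoo.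
  by move: Hab; rewrite aoo gt0_mulye// ltNge leey.
exists (fine (alpha R d)); rewrite fineK//.
have a0 : 0 < fine (alpha R d) by rewrite fine_gt0// al0 ltey_eq alf.
split => //; first exact: ltW.
set a := fine (alpha R d) in a0 *; rewrite ltNge; apply/negP => Ha.
have a1 : 0 < 1 + a by lra.
have b1 : (1 + a)^-1 < 1 by rewrite invf_lt1//; lra.
have := @lambda_ge _ beta (1 + a)^-1; rewrite invr_gt0 => /(_ a1 b1).
rewrite -[X in X <= _](mul1r) ler_pdivrMr// => /(_ Ha) lge.
have : (1 <= alpha R d * lambda beta)%E.
  apply: le_trans (lee_wpmul2l (ltW al0) lge).
  rewrite -(fineK alf) -/a -EFinM lee_fin.
  suff -> : a * ((1 + a)^-1 / (1 - (1 + a)^-1)) = 1 by [].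
  by field; rewrite !lt0r_neq0//; lra.
by rewrite leNgt Hab.
Qed.

End small_disorder_alpha.

(** * Convergence of the partition functions *)

(* completed_measure_extension Q0 lives on the Caratheodory-measurable sets of
   the outer measure of Q0, that is, on the completion of the canonical
   sigma-algebra *)
Theorem theorem2p1 (R : realType) (d : nat) (hd : (3 <= d)%N)
    (dT : measure_display) (T : measurableType dT) (P : probability T R)
    (J : nat -> T -> R) (X : nat -> T -> lattice d)
    (hwalk : simple_random_walk P J X)
    (Q0 : probability (path_space d R) R) (hQ0 : wiener_environment Q0)
    (beta : R) (hbeta : 0 < beta) (hsmall : (alpha R d * lambda beta < 1)%E)
    (x : lattice d) (s : R) :
  exists Zinf : environment d R -> R,
    cvg_L2 (@completed_measure_extension _ _ _ Q0) s
      (fun t => Zline P J X beta x s t) Zinf.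
Proof.
have d_gt0 : (0 < d)%N by apply: leq_trans hd.
have [a [alphaE a0 rho1]] := small_disorder d_gt0 hbeta hsmall.
have [C HC] := pair_correlation_bounded hwalk d_gt0 hQ0 x s hbeta alphaE a0 rho1.
pose G m := pair_correlation J X Q0 beta x s m m.
pose M m := fine (\int[walk_pair P]_p G m p).
have G0 m p : (0 <= G m p)%E by apply: integral_ge0 => om _; exact: pair_weight_ge0.
have mG m : s < m -> measurable_fun setT (G m).
  by move=> sm; exact: (measurable_pair_correlation hwalk hQ0).
have ME m : s < m -> (\int[walk_pair P]_p G m p = (M m)%:E)%E.
  move=> sm; rewrite fineK// ge0_fin_numE; last exact: integral_ge0.
  exact: le_lt_trans (HC m sm) (ltry _).
have mZ t : s < t ->
    measurable_fun setT (Zline P J X beta x s t : path_space d R -> \bar R).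
  by move=> st; exact: (measurable_Zline hwalk hQ0).
apply: (@mean_square_limit _ _ _ (@completed_measure_extension _ _ _ Q0) s
  (fun t => Zline P J X beta x s t) M C).
- by move=> t st; exact: (completed_measurable_fun (mZ t st)).
- by move=> t w st; exact: (Zline_ge0 hwalk hQ0).
- move=> t u st su.
  have sm : s < Num.min t u by rewrite lt_min st su.
  have corr : (\int[Q0]_om (Zline P J X beta x s t om * Zline P J X beta x s u om) =
      (M (Num.min t u))%:E)%E.
    apply: etrans (Zline_correlation hwalk hQ0 beta x st su) _.
    apply: etrans _ (ME _ sm); apply: eq_integral => p _.
    exact: (pair_correlation_min hwalk hQ0).
  have ZZ0 om : (0 <= Zline P J X beta x s t om * Zline P J X beta x s u om)%E.
    by rewrite mule_ge0//; [exact: (Zline_ge0 hwalk hQ0 beta x om st)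
      |exact: (Zline_ge0 hwalk hQ0 beta x om su)].
  rewrite -corr.
  exact: (completed_ge0_integral Q0 (emeasurable_funM (mZ t st) (mZ u su)) ZZ0).
- move=> t u st tu; have su := lt_le_trans st tu.
  have le_G : (\int[walk_pair P]_p G t p <= \int[walk_pair P]_p G u p)%E.
    apply: ge0_le_integral => //; [exact: mG|exact: mG|].
    by move=> p _; exact: (pair_correlation_nd hwalk hQ0).
  by move: le_G; rewrite (ME t st) (ME u su) lee_fin.
- by move=> t st; have := HC t st; rewrite -/(G t) (ME t st) lee_fin.
Qed.
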